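(* Let $q\ge2$ and $d\ge 2$ be integers and let $\mathfrak L_q$ be a commutative ring with unit $1$ of order $|\mathfrak L_q|=q$. Suppose $\mathfrak L_q$ contains distinct elements $\ell_1,\dots,\ell_{d-1}$ such that their pairwise differences $\ell_i-\ell_j$ ($i\ne j$) are invertible. Let $$\mathcal R_d(\mathfrak L_q)=\mathfrak L_q[(t+\ell_1)^{-1},\dots,(t+\ell_{d-1})^{-1},t]$$ be the ring of all polynomials over $\mathfrak L_q$ in $(t+\ell_1)^{-1},\dots,(t+\ell_{d-1})^{-1},t$. Then the Diestel-Leader graph $\mathrm{DL}_d(q)$ is (isomorphic to) the Cayley graph of the group $\Gamma_d(\mathfrak L_q)$ of affine matrices $$\begin{pmatrix}(t+\ell_1)^{k_1}\cdots(t+\ell_{d-1})^{k_{d-1}}&P\\0&1\end{pmatrix},\qquad k_1,\dots,k_{d-1}\in\mathbb Z,\ P\in\mathcal R_d(\mathfrak L_q),$$ with respect to the generators $$\begin{pmatrix}t+\ell_i&b\\0&1\end{pmatrix}^{\pm1},\quad b\in\mathfrak L_q,\ i\in\{1,\dots,d-1\},$$ and $$\begin{pmatrix}(t+\ell_i)(t+\ell_j)^{-1}&-b(t+\ell_j)^{-1}\\0&1\end{pmatrix},\quad b\in\mathfrak L_q,\ i,j\in\{1,\dots,d-1\},\ i\ne j.$$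
   Context: Here $t$ is an indeterminate; elements of $\mathcal R_d(\mathfrak L_q)$ are the finite sums $\sum_{k_1,\dots,k_{d-1}\in\mathbb Z}a_{k_1,\dots,k_{d-1}}(t+\ell_1)^{k_1}\cdots(t+\ell_{d-1})^{k_{d-1}}$ with coefficients in $\mathfrak L_q$, i.e. $\mathcal R_d(\mathfrak L_q)$ is the localization of $\mathfrak L_q[t]$ at the elements $t+\ell_1,\dots,t+\ell_{d-1}$. For an integer $q\ge 2$, $\mathbb T_q$ is the homogeneous tree in which every vertex has $q+1$ neighbours, with graph metric $d(\cdot,\cdot)$, a fixed origin $o$ and a fixed end $\omega$ (an end is a class of one-sided infinite geodesic rays, two rays being equivalent if their symmetric difference is finite). Let $x\curlywedge y$ be the maximal common ancestor of $x,y$, i.e. the first common vertex of the geodesic rays from $x$ and from $y$ that represent $\omega$. The Busemann function is $\mathfrak h(x)=d(x,x\curlywedge o)-d(o,x\curlywedge o)$. The Diestel-Leader graph $\mathrm{DL}_d(q)=\mathrm{DL}(q,\dots,q)$ ($d$ times) has vertex set $\{x_1\cdots x_d\in(\mathbb T_q)^d:\ \mathfrak h(x_1)+\dots+\mathfrak h(x_d)=0\}$, and $x_1\cdots x_d$, $y_1\cdots y_d$ are neighbours iff there are $i\ne j$ such that $x_i\sim y_i$, $x_j\sim y_j$ in $\mathbb T_q$ and $x_k=y_k$ for all $k\ne i,j$. For a group $\Gamma$ with finite generating set $S=S^{-1}$, the Cayley graph has vertex set $\Gamma$ and edges $[x,y]$ whenever $x^{-1}y\in S$. *)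

(* Defs.v *)
From HB Require Import structures.
From mathcomp Require Import all_boot all_order all_algebra.
From mathcomp Require Import boolp classical_sets functions cardinality.
From mathcomp Require Import ring.

Set Implicit Arguments.
Unset Strict Implicit.
Unset Printing Implicit Defensive.

Import Order.TTheory GRing.Theory Num.Theory.
Local Open Scope classical_set_scope.
Local Open Scope ring_scope.
Local Open Scope quotient_scope.
Local Open Scope card_scope.

(* The localization of L[t] at t + l_0, ..., t + l_{n-1}, as the quotient of
   the pairs (p, k), standing for p / \prod_i (t + l_i) ^+ k i.  The
   denominators are monic, hence not zero divisors, even if L is not an
   integral domain: the usual relation
     exists s, s * (p1 * den k2 - p2 * den k1) = 0   (s a denominator)
   on fractions needs no extra factor s.  The lemmas inj_injective,
   inj_den_unit and fracE identify the result with the ring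
   L[(t + l_0)^-1, ..., (t + l_{n-1})^-1, t]. *)
Module Localization.
Section Localization.
Variables (L : comNzRingType) (n : nat) (l : 'I_n -> L).

Local Notation pair := ({poly L} * {ffun 'I_n -> nat})%type.
Implicit Types (x y z : pair) (k : {ffun 'I_n -> nat}).

Definition den k : {poly L} := \prod_i ('X + (l i)%:P) ^+ k i.
Definition den0 : {ffun 'I_n -> nat} := [ffun=> 0%N].
Definition denadd k1 k2 : {ffun 'I_n -> nat} := [ffun i => (k1 i + k2 i)%N].

Lemma den_den0 : den den0 = 1.
Proof. by rewrite /den big1 // => i _; rewrite ffunE expr0. Qed.

Lemma den_add k1 k2 : den (denadd k1 k2) = den k1 * den k2.
Proof.
by rewrite /den -big_split; apply: eq_bigr => i _; rewrite ffunE exprD.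
Qed.

Lemma den_monic k : den k \is monic.
Proof.
by apply: monic_prod => i _; apply: monic_exp; rewrite monicXaddC.
Qed.

Lemma den_reg k : GRing.lreg (den k).
Proof. by apply: lreg_lead; rewrite (monicP (den_monic k)); apply: lreg1. Qed.

Definition equiv x y := x.1 * den y.2 == y.1 * den x.2.

Lemma equiv_refl : reflexive equiv.
Proof. by move=> x; rewrite /equiv. Qed.

Lemma equiv_sym : symmetric equiv.
Proof. by move=> x y; rewrite /equiv eq_sym. Qed.

Lemma equiv_trans : transitive equiv.
Proof.
move=> y x z; rewrite /equiv => /eqP xy /eqP yz; apply/eqP.
apply: (@den_reg y.2).
by rewrite mulrCA [den y.2 * _]mulrC mulrA xy mulrAC yz mulrAC mulrC mulrA.
Qed.

Canonical equiv_equiv := EquivRel equiv equiv_refl equiv_sym equiv_trans.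

Definition type := {eq_quot equiv}.

#[export] HB.instance Definition _ : EqQuotient _ equiv type := EqQuotient.on type.
#[export] HB.instance Definition _ := Choice.on type.

Lemma equiv_repr x :
  x.1 * den (repr (\pi_type x)).2 = (repr (\pi_type x)).1 * den x.2.
Proof. by apply/eqP; rewrite -/(equiv _ _) -eqmodE reprK. Qed.

Definition inj := lift_embed type (fun p : {poly L} => (p, den0) : pair).
Canonical inj_pi_morph := PiEmbed inj.

Definition addp x y : pair :=
  (x.1 * den y.2 + y.1 * den x.2, denadd x.2 y.2).
Definition add := lift_op2 type addp.

Lemma pi_add : {morph \pi : x y / addp x y >-> add x y}.
Proof.
move=> x y; unlock add; apply/eqmodP; rewrite /= /equiv /addp /= !den_add.
have := equiv_repr y; have := equiv_repr x.
set x' := repr _; set y' := repr _ => ex ey; apply/eqP.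
rewrite !mulrDl; congr (_ + _).
  transitivity (x.1 * den x'.2 * (den y.2 * den y'.2)); first by ring.
  by rewrite ex; ring.
transitivity (y.1 * den y'.2 * (den x.2 * den x'.2)); first by ring.
by rewrite ey; ring.
Qed.
Canonical pi_add_morph := PiMorph2 pi_add.

Definition oppp x : pair := (- x.1, x.2).
Definition opp := lift_op1 type oppp.

Lemma pi_opp : {morph \pi : x / oppp x >-> opp x}.
Proof.
move=> x; unlock opp; apply/eqmodP; rewrite /= /equiv /oppp /=.
by rewrite !mulNr equiv_repr.
Qed.
Canonical pi_opp_morph := PiMorph1 pi_opp.

Definition mulp x y : pair := (x.1 * y.1, denadd x.2 y.2).
Definition mul := lift_op2 type mulp.

Lemma pi_mul : {morph \pi : x y / mulp x y >-> mul x y}.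
Proof.
move=> x y; unlock mul; apply/eqmodP; rewrite /= /equiv /mulp /= !den_add.
by rewrite mulrACA !equiv_repr mulrACA.
Qed.
Canonical pi_mul_morph := PiMorph2 pi_mul.

Lemma denaddA : associative denadd.
Proof. by move=> a b c; apply/ffunP=> i; rewrite !ffunE addnA. Qed.

Lemma denaddC : commutative denadd.
Proof. by move=> a b; apply/ffunP=> i; rewrite !ffunE addnC. Qed.

Lemma denadd0 : left_id den0 denadd.
Proof. by move=> a; apply/ffunP=> i; rewrite !ffunE add0n. Qed.

Lemma addA : associative add.
Proof.
elim/quotW=> x; elim/quotW=> y; elim/quotW=> z; rewrite !piE.
rewrite /addp /= denaddA !den_add !mulrDl !mulrA !addrA; congr (\pi_type (_, _)).
by congr (_ + _ + _); ring.
Qed.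

Lemma addC : commutative add.
Proof.
by elim/quotW=> x; elim/quotW=> y; rewrite !piE /addp addrC denaddC.
Qed.

Lemma add0_l : left_id (inj 0) add.
Proof.
elim/quotW=> [[p k]]; rewrite !piE /addp /=.
by rewrite mul0r add0r denadd0 den_den0 mulr1.
Qed.

Lemma addN_l : left_inverse (inj 0) opp add.
Proof.
elim/quotW=> x; apply/eqP; rewrite piE /equiv /addp /oppp /=.
by rewrite mul0r mulNr addNr mul0r.
Qed.

#[export] HB.instance Definition _ := GRing.isZmodule.Build type addA addC add0_l addN_l.

Lemma mulA : associative mul.
Proof.
elim/quotW=> x; elim/quotW=> y; elim/quotW=> z; rewrite !piE.
by rewrite /mulp /= mulrA denaddA.
Qed.

Lemma mulC : commutative mul.
Proof.
by elim/quotW=> x; elim/quotW=> y; rewrite !piE /mulp mulrC denaddC.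
Qed.

Lemma mul1_l : left_id (inj 1) mul.
Proof. by elim/quotW=> [[p k]]; rewrite !piE /mulp /= mul1r denadd0. Qed.

Lemma mul_addl : left_distributive mul add.
Proof.
elim/quotW=> x; elim/quotW=> y; elim/quotW=> z; apply/eqP.
rewrite !piE /equiv /mulp /addp /= !den_add; apply/eqP.
by ring.
Qed.

Lemma nonzero1 : inj 1 != inj 0.
Proof. by rewrite piE /equiv /= den_den0 !mulr1 oner_eq0. Qed.

#[export] HB.instance Definition _ :=
  GRing.Zmodule_isComNzRing.Build type mulA mulC mul1_l mul_addl nonzero1.

Definition unit : {pred type} := fun a => `[< exists b, b * a = 1 >].
Definition inv (a : type) : type := xget a [set b | b * a = 1].

Lemma mulVx : {in unit, left_inverse 1 inv *%R}.
Proof. by move=> a /asboolP[b ba]; rewrite /inv; case: xgetP => // /(_ b). Qed.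

Lemma unitPl (a b : type) : b * a = 1 -> unit a.
Proof. by move=> ba; apply/asboolP; exists b. Qed.

Lemma inv_out : {in [predC unit], inv =1 id}.
Proof.
move=> a /asboolPn na; rewrite /inv; case: xgetP => // b _ ba.
by case: na; exists b.
Qed.

#[export] HB.instance Definition _ :=
  GRing.ComNzRing_hasMulInverse.Build type mulVx unitPl inv_out.

Lemma inj_is_zmod_morphism : zmod_morphism inj.
Proof.
move=> p q; unlock inj; rewrite -[X in _ = _ + X]pi_opp -[RHS]pi_add.
by rewrite /addp /oppp /= den_den0 !mulr1 denadd0.
Qed.

Lemma inj_is_monoid_morphism : monoid_morphism inj.
Proof.
by split=> [//|p q]; unlock inj; rewrite -[RHS]pi_mul /mulp /= denadd0.
Qed.

#[export] HB.instance Definition _ :=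
  GRing.isZmodMorphism.Build {poly L} type inj inj_is_zmod_morphism.
#[export] HB.instance Definition _ :=
  GRing.isMonoidMorphism.Build {poly L} type inj inj_is_monoid_morphism.

Lemma inj_injective : injective inj.
Proof.
move=> p q; unlock inj => /eqmodP; rewrite /= /equiv /= => /eqP.
by rewrite den_den0 !mulr1.
Qed.

Lemma inj_den_unit k : inj (den k) \is a GRing.unit.
Proof.
apply/unitrP; exists (\pi_type (1, k)); rewrite mulrC; split;
  rewrite [LHS]piE -[1 in RHS]/(inj 1) piE; apply/eqmodP;
  by rewrite /= /equiv /mulp /= den_add den_den0 !mulr1 !mul1r.
Qed.

Lemma fracE (a : type) : exists p k, a = inj p / inj (den k).
Proof.
elim/quotW: a => [[p k]]; exists p, k.
apply: (mulIr (inj_den_unit k)); rewrite divrK ?inj_den_unit //.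
rewrite [LHS]piE [RHS]piE; apply/eqmodP.
by rewrite /= /equiv /mulp /= den_add den_den0 !mulr1 ?mul1r.
Qed.

End Localization.
Module Exports. HB.reexport. End Exports.
End Localization.
Export Localization.Exports.

Notation locring := Localization.type.

(* Graphs are given by their adjacency relation. *)

Definition graph_iso (V W : Type) (E : V -> V -> Prop) (F : W -> W -> Prop) :=
  exists f : V -> W,
    bijective f /\ forall x y, E x y <-> F (f x) (f y).

Section Tree.
Variables (V : choiceType) (e : rel V).
Implicit Types (x y z o : V) (r s : nat -> V) (omega : set (nat -> V)).

Definition walk_length x y : set nat :=
  [set m | exists p : seq V, [/\ path e x p, last x p = y & size p = m]].

(* The value 0 is taken when there is no walk from x to y. *)
Definition gdist x y : nat :=
  xget 0%N [set m | walk_length x y m /\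
                    forall m', walk_length x y m' -> (m <= m')%N].

Definition is_tree : Prop :=
  [/\ symmetric e, irreflexive e,
      forall x y, exists m, walk_length x y m &
      forall c : seq V, (2 < size c)%N -> ~~ ucycleb e c].

Definition is_homogeneous_tree (q : nat) : Prop :=
  is_tree /\ forall x, [set y | e x y] #= `I_q.+1.

Definition geodesic_ray r : Prop :=
  forall m k : nat, gdist (r m) (r (m + k)%N) = k.

Definition ray_equiv r s : Prop := finite_set (range r `+` range s).

Definition is_end omega : Prop :=
  exists r, geodesic_ray r /\
    omega = [set s | geodesic_ray s /\ ray_equiv r s].

Definition is_confluent omega x y z : Prop :=
  exists r s (m k : nat),
    [/\ omega r, r 0%N = x, omega s & s 0%N = y] /\
    [/\ r m = z, s k = z &
        forall m' k', r m' = s k' -> (m <= m')%N /\ (k <= k')%N].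

(* In a tree with end omega, the confluent is unique and exists. *)
Definition confluent omega x y : V := xget x [set z | is_confluent omega x y z].

Definition busemann omega o x : int :=
  (gdist x (confluent omega x o))%:Z - (gdist o (confluent omega x o))%:Z.

(* DL_d(q) is built from d copies of one tree, with the same origin and end. *)
Definition DL_vertex omega o (d : nat) : set {ffun 'I_d -> V} :=
  [set x : {ffun 'I_d -> V} | \sum_(i < d) busemann omega o (x i) = 0].
Arguments DL_vertex : clear implicits.

Definition DL_adj omega o (d : nat) (x y : DL_vertex omega o d) : Prop :=
  exists i j : 'I_d,
    [/\ i != j, e (val x i) (val y i), e (val x j) (val y j) &
        forall k, k != i -> k != j -> val x k = val y k].

End Tree.

Arguments DL_vertex {V} e omega o d.
Arguments DL_adj {V} e omega o d x y.

Section Cayley.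
Variables (U : unitRingType).
Implicit Types G S H : set U.

Definition is_subgroup G : Prop :=
  [/\ G `<=` [set x | x \is a GRing.unit], G 1,
      forall x y, G x -> G y -> G (x * y) & forall x, G x -> G x^-1].

Definition is_generating_set G S : Prop :=
  [/\ finite_set S, forall x, S x -> S x^-1, S `<=` G &
      forall H, is_subgroup H -> S `<=` H -> G `<=` H].

Definition cayley_adj G S (x y : G) : Prop := S ((val x)^-1 * val y).

(* The graph (V, E) is isomorphic to the Cayley graph of G with respect to S,
   which presupposes that S is a finite symmetric generating set of G. *)
Definition is_cayley_graph (V : Type) (E : V -> V -> Prop) G S : Prop :=
  [/\ is_subgroup G, is_generating_set G S & graph_iso E (@cayley_adj G S)].

End Cayley.

Section AffineGroup.
Variables (L : comNzRingType) (n : nat) (l : 'I_n -> L).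

Definition tl (i : 'I_n) : locring l := Localization.inj l ('X + (l i)%:P).

Definition cst (b : L) : locring l := Localization.inj l b%:P.

Definition aff (a P : locring l) : 'M[locring l]_2 :=
  \matrix_(i < 2, j < 2) nth 0 (nth [::] [:: [:: a; P]; [:: 0; 1]] i) j.

Definition Gamma : set 'M[locring l]_2 :=
  [set A | exists (k : 'I_n -> int) (P : locring l),
             A = aff (\prod_(i < n) tl i ^ k i) P].

Definition Gamma_gens : set 'M[locring l]_2 :=
  [set A | exists i b, A = aff (tl i) (cst b) \/ A = (aff (tl i) (cst b))^-1]
  `|` [set A | exists i j b, i != j /\
                 A = aff (tl i / tl j) (- (cst b / tl j))].

End AffineGroup.

Arguments Gamma {L n} l.
Arguments Gamma_gens {L n} l.

(* Main.v *)
Require Import Defs.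
From mathcomp Require Import all_boot all_order all_algebra.
From mathcomp Require Import boolp classical_sets functions cardinality.
From mathcomp Require Import perm ring zify.

(** Each of the d trees is the tree of balls of the ring R of Laurent
polynomials in the t + l_i, for one of d places: the d - 1 points t = - l_i
and the point at infinity.  A ball of height h at a place is a coset of the
additive subgroup [fil] of the elements that vanish there to order at least h
(at infinity: of degree less than - h); its parent is the ball of height h - 1
around it.  A ball of height h contains exactly q balls of height h + 1: at a
finite place because evaluation at - l_i is defined on elements without pole,
the differences of the l_i being invertible, and at infinity by the
coefficient of highest degree ([fil_digit], [fil_digit0]).

A tree with a chosen end is determined by its parent function, its heights
and the number of children ([horotree_iso]), so that the given homogeneous
tree is isomorphic to the tree of balls of each place
([homogeneous_horotree], [ball_horotree]).  A vertex of the Diestel-Leader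
graph thus becomes a family of balls, one for each place, whose heights have
sum 0.  The heights at the finite places are the exponents of a monomial u in
the t + l_i, the height at infinity being minus its degree, and there is
exactly one P in R that lies in all the balls: it is unique because an
element without poles and of negative degree is zero ([fil_cap]), and it
exists by partial fractions ([fil_crt]).  So the vertices are the pairs
(u, P), that is, the elements of the group.

With the convention t + l_oo := 1 all the generators have one form: for places
i <> j and b in L, the matrix with diagonal entry (t + l_i) / (t + l_j) and
translation part b / (t + l_j).  Multiplication of (u, P) by it on the right
replaces u by u (t + l_i) / (t + l_j) and P by P + b u / (t + l_j): the ball at
j is replaced by its parent, the ball at i by the child of digit b, and the
other balls do not change ([affgen_dl_step], [dl_step_affgen]).  These are
exactly the edges of the Diestel-Leader graph. *)

Set Implicit Arguments.
Unset Strict Implicit.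
Unset Printing Implicit Defensive.

Import Order.TTheory GRing.Theory Num.Theory.
Local Open Scope nat_scope.

(** * Rays in a tree *)

Section Tree.
Variables (V : choiceType) (e : rel V).
Hypothesis eT : is_tree e.
Implicit Types (x y z a b : V) (p : seq V) (r s : nat -> V).

Let eS : symmetric e. Proof. by case: eT. Qed.
Let eI : irreflexive e. Proof. by case: eT. Qed.

(** Otherwise x and a simple path extracted from the walk would form a cycle. *)
Lemma tree_avoid x a p : path e a p -> x \notin a :: p ->
  e x a -> e x (last a p) -> last a p = a.
Proof.
case/shortenP=> p' ep' Up' sub xNp xa xl; apply/eqP/negPn/negP => neq.
have xNp' : x \notin a :: p'.
  apply: contra xNp; rewrite !inE => /orP[->//|/sub ->]; exact: orbT.
case: eT => _ _ _ /(_ [:: x, a & p']) /=; case: p' => [|b p'] in ep' Up' sub xl neq xNp' *.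
  by rewrite eqxx in neq.
move=> /(_ isT) /negP; apply; rewrite /ucycleb; apply/andP; split; last first.
  by rewrite cons_uniq xNp'.
by rewrite /= rcons_path -/(path e a (b :: p')) xa; move: ep' => /= /andP[-> ->] /=; rewrite eS.
Qed.

(** Two paths that leave x by different edges and meet again would join these two
neighbours of x by a walk that avoids x. *)
Lemma tree_path_uniq x p p' : path e x p -> uniq (x :: p) ->
  path e x p' -> uniq (x :: p') -> last x p = last x p' -> p = p'.
Proof.
elim: p x p' => [|a p IH] x [|b p'] //.
- by move=> _ _ _ /= /andP[xN _] xe; rewrite [X in X \notin _]xe mem_last in xN.
- by move=> _ /= /andP[xN _] _ _ xe; rewrite -[X in X \notin _]xe mem_last in xN.
move=> /= /andP[xa ep] /andP[xNp Up] /andP[xb ep'] /andP[xNp' Up'] el.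
have lE : last (last b p') (rev (belast b p')) = b.
  by case: (p') => //= c s; rewrite rev_cons last_rcons.
have : last a (p ++ rev (belast b p')) = a.
  apply: (@tree_avoid x) => //; last by rewrite last_cat el lE.
    rewrite cat_path ep el rev_path.
    by rewrite (eq_path (e' := e)) // => u v /=; rewrite eS.
  rewrite -cat_cons mem_cat negb_or xNp mem_rev.
  by apply: contra xNp'; apply: mem_belast.
rewrite last_cat el lE => ab; subst b.
by congr (_ :: _); apply: (IH a).
Qed.

Lemma gdist_path x p : path e x p -> uniq (x :: p) -> gdist e x (last x p) = size p.
Proof.
move=> ep Up; have min m : walk_length e x (last x p) m -> size p <= m.
  move=> [p1 [ep1 l1 <-]]; case/shortenP: ep1 l1 => p2 ep2 Up2 sub l2.
  rewrite -(tree_path_uniq ep2 Up2 ep Up l2); apply: uniq_leq_size => //.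
  by move: Up2 => /= /andP[].
apply: xget_unique; first by split=> //; exists p.
move=> m [wm minm]; apply/eqP; rewrite eqn_leq min // andbT minm //.
by exists p.
Qed.

Lemma tree_geodesic x y :
  exists p, [/\ path e x p, uniq (x :: p), last x p = y & size p = gdist e x y].
Proof.
case: eT => _ _ /(_ x y)[m [p [ep <- _]]] _.
by case/shortenP: ep => p' ep' Up' _; exists p'; split=> //; rewrite gdist_path.
Qed.

(** Rays without backtracking.  In a tree these are the geodesic rays
([geodesic_rayE]), described by a local condition that is easy to check when a
ray is shortened or extended. *)
Definition nbray r := forall n, e (r n) (r n.+1) /\ r n <> r n.+2.

Lemma nbray_shift r m : nbray r -> nbray (fun n => r (m + n)).
Proof. by move=> rP n; rewrite !addnS; apply: rP. Qed.

Lemma nbray_path r k : nbray r -> path e (r 0) (mkseq (fun i => r i.+1) k).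
Proof.
move=> rP; elim: k => // k IH.
rewrite mkseqS rcons_path IH /=.
have -> : last (r 0) (mkseq (fun i => r i.+1) k) = r k.
  by case: (k) => // k'; rewrite mkseqS last_rcons.
by case: (rP k).
Qed.

Lemma last_mkseq_ray r k : last (r 0) (mkseq (fun i => r i.+1) k) = r k.
Proof. by case: k => // k; rewrite mkseqS last_rcons. Qed.

(** At a first return to [r 0], the vertex before the return and [r 1] would be
neighbours of [r 0] joined by a walk that avoids [r 0], hence equal; but the ray
from [r 1] does not return to [r 1] earlier. *)
Lemma nbray_neq0 k r : nbray r -> r 0 <> r k.+1.
Proof.
elim/ltn_ind: k r => -[|[|k]] IH r rP.
- by move=> r01; have [] := rP 0; rewrite -r01 eI.
- by case: (rP 0).
move=> r0; have := @nbray_path _ k.+1 (nbray_shift 1 rP).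
move=> /(@tree_avoid (r 0)); rewrite (@last_mkseq_ray (fun n => r (1 + n))).
case: (rP 0) => r01 _; case: (rP k.+2) => rk _.
move=> /(_ _ r01); rewrite r0 in rk * => Hx.
have /esym : r k.+2 = r 1.
  apply: Hx; last by rewrite eS.
  rewrite -r0 inE; apply/norP; split; first by apply/eqP; apply: (IH 0).
  apply/mapP => -[j]; rewrite mem_iota => /andP[_ jk].
  by apply: (IH j.+1).
exact: (IH k _ _ (nbray_shift 1 rP)).
Qed.

Lemma nbray_inj r : nbray r -> injective r.
Proof.
move=> rP; have lt m k : r m <> r (m + k.+1).
  by have := nbray_neq0 (k := k) (nbray_shift m rP); rewrite addn0.
move=> m n rmn; case: (ltngtP m n) => // lmn.
  by case: (lt m (n - m).-1); rewrite prednK ?subn_gt0 // subnKC // ltnW.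
by case: (lt n (m - n).-1); rewrite prednK ?subn_gt0 // subnKC // ltnW.
Qed.

Lemma nbray_uniq r k : nbray r -> uniq (r 0 :: mkseq (fun i => r i.+1) k).
Proof.
move=> rP; have := mkseq_uniq k.+1 (nbray_inj rP).
by rewrite /mkseq /= (iotaDl 1 0) -map_comp.
Qed.

Lemma nbray_gdist r m k : nbray r -> gdist e (r m) (r (m + k)) = k.
Proof.
move=> rP; have rPm := nbray_shift m rP.
have := gdist_path (nbray_path k rPm) (nbray_uniq k rPm).
by rewrite (@last_mkseq_ray (fun n => r (m + n))) addn0 size_mkseq.
Qed.

Lemma geodesic_rayE r : geodesic_ray e r <-> nbray r.
Proof.
split=> [gr n|rP m k]; last exact: nbray_gdist.
split.
  have [[|y [|z p]] [+ _ + +]] := tree_geodesic (r n) (r n.+1);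
    rewrite -[n.+1]addn1 gr //=.
  by rewrite andbT => ey <- _.
move=> rn; have [p [_ + + +]] := tree_geodesic (r n) (r n.+2).
rewrite -[n.+2]addn2 gr addn2 -rn; case: p => // y p /= /andP[xN _] lx.
by rewrite -[X in X \notin _]lx mem_last in xN.
Qed.

(** Up to the meeting point, both rays run along the only simple path. *)
Lemma nbray_agree r s i j : nbray r -> nbray s -> r 0 = s 0 -> r i = s j ->
  i = j /\ forall n, n <= i -> r n = s n.
Proof.
move=> rP sP rs0 rsij.
have : mkseq (fun n => r n.+1) i = mkseq (fun n => s n.+1) j.
  apply: (@tree_path_uniq (r 0)); rewrite ?nbray_uniq ?nbray_path //.
  - by rewrite rs0 nbray_path.
  - by rewrite rs0 nbray_uniq.
  - by rewrite {2}rs0 !last_mkseq_ray.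
move=> E; have ij : i = j by rewrite -(size_mkseq (fun n => r n.+1) i) E size_mkseq.
split=> // -[|n] ni //; rewrite -ij in E.
by move: E => /(congr1 (fun p => nth (r 0) p n)); rewrite !nth_mkseq.
Qed.

(** The rays have a common tail.  For geodesic rays this is the equivalence that
defines ends ([ray_equivE]). *)
Definition merges r s := exists m k, forall n, s (m + n) = r (k + n).

(** Both rays run to a common vertex arbitrarily far on r, along the only simple
path. *)
Lemma merges_unique r s s' : nbray s -> nbray s' -> merges r s -> merges r s' ->
  s 0 = s' 0 -> s =1 s'.
Proof.
move=> sP s'P [m [k E]] [m' [k' E']] s0 n.
have mt : s (m + (k' + n)) = s' (m' + (k + n)) by rewrite E E' addnCA.
have [_ ->//] := nbray_agree sP s'P s0 mt.
by rewrite addnA leq_addl.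
Qed.

(** If s goes through x, its first vertex is removed; otherwise x is put in front
of it.  The last alternative tells which of [s 0] and x follows the other on the
way to the end. *)
Lemma merging_ray_step r s x : nbray s -> merges r s -> e (s 0) x ->
  exists2 s', nbray s' /\ merges r s' & s' 0 = x /\
    (s 1 = x /\ (forall n, s' n = s n.+1) \/ s' 1 = s 0).
Proof.
move=> sP [m [k E]] s0x; have [x1|/eqP xN1] := eqVneq x (s 1).
  exists (fun n => s n.+1); last by split=> //; left.
  split=> [n|]; first exact: sP.
  by exists m, k.+1 => n; rewrite -addnS E addnS.
exists (fun n => if n is n'.+1 then s n' else x); last by split=> //; right.
split; last by exists m.+1, k => n; rewrite addSn E.
by case=> [|n]; [rewrite eS | apply: sP].
Qed.

(** The ray r is carried along a walk from [r 0] to x by [merging_ray_step]. *)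
Lemma merging_ray_ex r x : nbray r ->
  exists s, [/\ nbray s, merges r s & s 0 = x].
Proof.
move=> rP; case: eT => _ _ /(_ (r 0) x)[_ [p [ep <- _]]] _.
have : exists s, [/\ nbray s, merges r s & s 0 = r 0].
  by exists r; split=> //; exists 0, 0.
elim: p (r 0) ep => [|a p IH] y //= /andP[ya ep] [s [sP ms s0]].
apply: IH => //; rewrite -s0 in ya.
have [s' [? ?] [? _]] := merging_ray_step sP ms ya.
by exists s'.
Qed.

(** If the symmetric difference is finite, s meets r arbitrarily far.  There it
also meets the ray from [s 0] that merges with r, so the two agree everywhere. *)
Lemma ray_equivE r s : nbray r -> nbray s -> ray_equiv r s <-> merges r s.
Proof.
move=> rP sP; split=> [rs|[m [k E]]]; last first.
  apply: (@sub_finite_set _ _ (s @` `I_m `|` r @` `I_k)%classic).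
    move=> x /= [] [[n _ <-]] xN.
      have [kn|nk] := leqP k n; last by right; exists n.
      by exfalso; apply: xN; exists (m + (n - k)) => //; rewrite E subnKC.
    have [mn|nm] := leqP m n; last by left; exists n.
    by exfalso; apply: xN; exists (k + (n - m)) => //; rewrite -E subnKC.
  by rewrite finite_setU; split; apply: finite_image.
have [M MP] : exists M, forall n, M <= n -> range s (r n).
  have : finite_set (r @^-1` (range r `\` range s))%classic.
    apply: finite_preimage; first by move=> ? ? _ _; apply: nbray_inj.
    by apply: sub_finite_set rs => x; left.
  move=> /finite_fsetP[X XE]; exists (\max_(i <- finmap.enum_fset X) i).+1 => n Mn.
  apply: contrapT => nN.
  have nX : n \in finmap.enum_fset X.
    have : (r @^-1` (range r `\` range s))%classic n by split => //; exists n.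
    by rewrite XE.
  by have := @leq_bigmax_seq _ _ xpredT (fun i : nat => i) _ nX isT; rewrite leqNgt Mn.
have [s' [s'P ms' s'0]] := merging_ray_ex (s 0) rP.
suff ss' : s = s' by rewrite ss'.
apply: funext => n.
have [m [k E]] := ms'.
have [j _ sj] : range s (r (k + (M + n))) by apply: MP; rewrite addnCA leq_addr.
rewrite -E in sj.
have [jE ->//] := nbray_agree sP s'P (esym s'0) sj.
by rewrite jE addnA leq_addl.
Qed.

End Tree.

(** [par x] is the second vertex of the only ray of the end that starts at x. *)
Lemma end_parent (V : choiceType) (e : rel V) (omega : set (nat -> V)) :
  is_tree e -> is_end e omega ->
  exists par : V -> V,
  [/\ forall x y, e x y <-> par x = y \/ par y = x,
      forall s, omega s <-> forall n, s n = iter n par (s 0),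
      forall x k, gdist e x (iter k par x) = k,
      forall x, injective (fun n => iter n par x) &
      forall x y, exists m k, iter m par x = iter k par y].
Proof.
move=> eT [r [/(geodesic_rayE eT) rP omegaE]].
have [R RP] := choice (fun x => merging_ray_ex eT x rP).
have nR x : nbray e (R x) by case: (RP x).
have mR x : merges r (R x) by case: (RP x).
have R0 x : R x 0 = x by case: (RP x).
pose par x := R x 1; exists par.
have R_unique s : nbray e s -> merges r s -> s =1 R (s 0).
  by move=> sP ms; apply: (merges_unique eT sP _ ms).
have iterR n x : R x n = iter n par x.
  elim: n x => [|n IH] x; first by rewrite R0.
  rewrite iterSr -IH; symmetry; have -> : par x = R x 1 by [].
  have := R_unique (fun n => R x (1 + n)) (nbray_shift 1 (nR x)).
  rewrite -[RHS]/(R x (1 + n)) => -> //.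
  by have [m [k E]] := mR x; exists m, k.+1 => j; rewrite add1n -addnS E addnS.
have epar x : e x (par x) by have [+ _] := nR x 0; rewrite R0.
split.
- move=> x y; split=> [xy|].
    rewrite -{1}(R0 x) in xy.
    have [s [sP ms] [s0 []]] := merging_ray_step eT (nR x) (mR x) xy.
      by case=> xy1 _; left.
    by rewrite R_unique // s0 R0; right.
  by case: eT => eS _ _ _; case=> <-; rewrite ?epar // eS epar.
- move=> s; rewrite omegaE; split=> [[/(geodesic_rayE eT) sP]|sE].
    by move=> /(ray_equivE eT rP sP) ms n; rewrite -iterR -R_unique.
  have -> : s = R (s 0) by apply: funext => n; rewrite iterR sE.
  by split; [apply/(geodesic_rayE eT); apply: nR | apply/(ray_equivE eT rP (nR _)); apply: mR].
- by move=> x k; have := nbray_gdist eT 0 k (nR x); rewrite add0n R0 iterR.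
- by move=> x m k; rewrite -!iterR; apply: (nbray_inj eT (nR x)).
move=> x y; have [m [k E]] := mR x; have [m' [k' E']] := mR y.
by exists (m + k'), (m' + k); rewrite -!iterR E E' addnC.
Qed.

Section Busemann.
Variables (V : choiceType) (e : rel V) (omega : set (nat -> V)) (par : V -> V).
Hypothesis omegaE : forall s, omega s <-> forall n, s n = iter n par (s 0).
Hypothesis gdist_par : forall x k, gdist e x (iter k par x) = k.
Hypothesis par_inj : forall x, injective (fun n => iter n par x).

(** Every common ancestor of x and o can be used instead of their confluent: beyond
the confluent, both distances grow alike. *)
Lemma busemannE o x m k : iter m par x = iter k par o ->
  busemann e omega o x = (m%:Z - k%:Z)%R.
Proof.
move=> Exo.
have omega_iter y : omega (fun n => iter n par y) by apply/omegaE.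
have : exists z, is_confluent omega x o z.
  have ex : exists m, `[< exists k, iter m par x = iter k par o >].
    by exists m; apply/asboolP; exists k.
  case: (ex_minnP ex) => m1 /asboolP[k1 E1] min1.
  exists (iter m1 par x), (fun n => iter n par x), (fun n => iter n par o), m1, k1.
  split; first by split.
  split=> // m' k' E'; have m1m' : m1 <= m' by apply: min1; apply/asboolP; exists k'.
  split=> //; suff -> : k' = m' - m1 + k1 by rewrite leq_addl.
  by apply: (par_inj (x := o)); rewrite /= iterD -E1 -iterD subnK.
move=> /(xgetPex x); rewrite /busemann /confluent.
move: (xget _ _) => z [r [s [m1 [k1 [[or r0 os s0] [rz sz min]]]]]].
have rE : r = fun n => iter n par x by apply: funext=> n; rewrite ((omegaE r).1 or) r0.
have sE : s = fun n => iter n par o by apply: funext=> n; rewrite ((omegaE s).1 os) s0.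
subst r s; rewrite -{1}rz -sz !gdist_par.
have [m1m k1k] := min _ _ Exo.
suff : k = m - m1 + k1 by move: m1m; lia.
by apply: (par_inj (x := o)); rewrite /= iterD sz -rz -iterD subnK.
Qed.

End Busemann.

(** * Trees with a chosen end *)

Local Open Scope ring_scope.

(** A tree seen from an end: [par] is the neighbour towards the end, [h] the
Busemann function with zero at [o], and [C] a set of labels for the children of
each vertex. *)
Record horotree (C X : Type) (par : X -> X) (h : X -> int) (o : X) : Prop := HoroTree {
  horo_root : h o = 0;
  horo_par : forall x, h (par x) = h x - 1;
  horo_confluent : forall x y, exists m k, iter m par x = iter k par y;
  horo_children : forall x, exists s : C -> X,
    injective s /\ forall y, par y = x <-> exists c, y = s c
}.

(** Of the #|L| + 1 neighbours of a vertex, one is its parent and the others are its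
children. *)
Theorem homogeneous_horotree (V : choiceType) (e : rel V) (L : finType) (o : V)
    (omega : set (nat -> V)) :
  is_homogeneous_tree e #|L| -> is_end e omega ->
  exists par : V -> V, (forall x y, e x y <-> par x = y \/ par y = x) /\
    horotree L par (busemann e omega o) o.
Proof.
move=> [eT eq] oend; have [par [parE omegaE gd pinj conf]] := end_parent eT oend.
have bE := busemannE omegaE gd pinj.
exists par; split=> //; split=> //.
- by rewrite (@bE _ _ 0%N 0%N).
- move=> x; have [m [k E]] := conf x o; rewrite (bE _ _ _ _ E).
  rewrite (@bE _ _ m k.+1); last by rewrite -iterSr iterS E.
  by rewrite -addn1 PoszD; ring.
move=> x.
have fE := card_fset_set (eq x).
have finE : finite_set [set y | e x y]%classic by apply/finite_setP; exists #|L|.+1.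
pose l := rem (par x) (finmap.enum_fset (fset_set [set y | e x y]%classic)).
have Fu : uniq (finmap.enum_fset (fset_set [set y | e x y]%classic)).
  exact: finmap.fset_uniq.
have memF y : (y \in finmap.enum_fset (fset_set [set y | e x y]%classic)) = e x y.
  transitivity (y \in [set y | e x y]%classic); first exact: in_fset_set.
  by apply/idP/idP => [/set_mem|xy] //; apply/mem_set.
have meml y : y \in l <-> par y = x.
  rewrite mem_rem_uniq // inE memF /=; split.
    by move=> /andP[/eqP yN /parE[]// xy]; case: yN.
  move=> <-; apply/andP; split; last by apply/parE; right.
  by apply/eqP => yE; have /= := pinj y 0%N 2%N; rewrite -yE => /(_ erefl).
have sl : size l = #|L|.
  by rewrite size_rem ?memF ?fE //; apply/parE; left.
exists (fun c => nth x l (enum_rank c)); split.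
  move=> c c' /eqP; rewrite nth_uniq ?sl // ?rem_uniq // => /eqP E.
  by apply: enum_rank_inj; apply: val_inj.
move=> y; split=> [/meml yl|[c ->]]; last by apply/meml; rewrite mem_nth // sl.
have il : (index y l < #|L|)%N by rewrite -sl index_mem.
by exists (enum_val (Ordinal il)); rewrite enum_valK nth_index.
Qed.

Section HorotreeIso.
Variables (C : finType) (c0 : C).

Lemma horo_iter X par (h : X -> int) o m x :
  horotree C par h o -> h (iter m par x) = h x - m%:Z.
Proof.
move=> hX; elim: m => [|m IH]; first by rewrite subr0.
by rewrite iterS (horo_par hX) IH -addn1 PoszD; ring.
Qed.

(** The labels can be chosen such that the ray from o to the end has label c0
throughout: a vertex is the parent of at most one vertex of this ray, by heights,
and a transposition gives that vertex the label c0. *)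
Lemma horo_labelling X par (h : X -> int) o : horotree C par h o ->
  exists s : X -> C -> X,
  [/\ forall x, injective (s x), forall x y, par y = x <-> exists c, y = s x c &
      forall m, s (iter m.+1 par o) c0 = iter m par o].
Proof.
move=> hX; suff /choice[s sP] : forall x, exists s : C -> X,
    [/\ injective s, forall y, par y = x <-> exists c, y = s c &
        forall m, x = iter m.+1 par o -> s c0 = iter m par o].
  exists s; split=> [x|x|m]; [by case: (sP x) | by case: (sP x) |].
  by case: (sP (iter m.+1 par o)) => _ _; apply.
move=> x; have [s [sI sP]] := horo_children hX x.
have [[m xE]|nx] := pselect (exists m, x = iter m.+1 par o); last first.
  by exists s; split=> // m xE; case: nx; exists m.
have /sP[c mE] : par (iter m par o) = x by rewrite xE.
exists (fun b => s (tperm c0 c b)); split=> [b b' /sI /perm_inj //|y|m' xE'].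
  rewrite sP; split=> -[b ->]; last by exists (tperm c0 c b).
  by exists (tperm c0 c b); rewrite tpermK.
rewrite tpermL -mE; congr (iter _ par o).
have /(congr1 h) : iter m.+1 par o = iter m'.+1 par o by rewrite -xE.
by rewrite !(horo_iter _ _ hX); lia.
Qed.

Section Match.
Variables (X Y : Type) (pX : X -> X) (pY : Y -> Y) (hX : X -> int) (hY : Y -> int).
Variables (oX : X) (oY : Y) (s : X -> C -> X) (t : Y -> C -> Y).

(** Two vertices match if they have the same height and, on their way to the end,
the same labels.  This is generated by the rays from the two origins, which have
the same labels, and by the descent to children with the same label. *)
Inductive horo_match : X -> Y -> Prop :=
| match_root m : horo_match (iter m pX oX) (iter m pY oY)
| match_child x y c : horo_match x y -> horo_match (s x c) (t y c).

Hypothesis hoX : horotree C pX hX oX.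
Hypothesis hoY : horotree C pY hY oY.
Hypothesis sP : forall x y, pX y = x <-> exists c, y = s x c.
Hypothesis tP : forall x y, pY y = x <-> exists c, y = t x c.
Hypothesis sI : forall x, injective (s x).
Hypothesis s0 : forall m, s (iter m.+1 pX oX) c0 = iter m pX oX.
Hypothesis t0 : forall m, t (iter m.+1 pY oY) c0 = iter m pY oY.

Lemma match_total x : exists y, horo_match x y.
Proof.
have [m [k]] := horo_confluent hoX x oX; elim: m x => [|m IH] x.
  by move=> /= ->; exists (iter k pY oY); apply: match_root.
rewrite iterSr => /IH[y xy].
have [c ->] := (sP _ _).1 (erefl (pX x)).
by exists (t y c); apply: match_child.
Qed.

(** The relation is generated downwards; this reads it upwards: matched vertices have
matched parents and equal labels. *)
Lemma match_par x y : horo_match x y ->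
  [/\ hX x = hY y, horo_match (pX x) (pY y) &
      exists c, x = s (pX x) c /\ y = t (pY y) c].
Proof.
case=> [m|x' y' c xy].
  split; first by rewrite (horo_iter _ _ hoX) (horo_iter _ _ hoY) (horo_root hoX) (horo_root hoY).
    by rewrite -!iterS; apply: match_root.
  by exists c0; rewrite -!iterS s0 t0.
have sx : pX (s x' c) = x' by apply/sP; exists c.
have ty : pY (t y' c) = y' by apply/tP; exists c.
rewrite sx ty; split=> //; last by exists c.
suff : hX x' = hY y'.
  by rewrite -{1}sx -{1}ty (horo_par hoX) (horo_par hoY) => /addIr.
elim: xy => [m|x1 y1 c1 _ IH].
  by rewrite (horo_iter _ _ hoX) (horo_iter _ _ hoY) (horo_root hoX) (horo_root hoY).
apply: (@addIr _ (-1)); rewrite -(horo_par hoX) -(horo_par hoY).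
have -> : pX (s x1 c1) = x1 by apply/sP; exists c1.
by have -> : pY (t y1 c1) = y1 by apply/tP; exists c1.
Qed.

(** The vertices y and y' have equal heights and a common ancestor.  Descending
from it, they are led by the labels of x to the same vertex. *)
Lemma match_functional x y y' : horo_match x y -> horo_match x y' -> y = y'.
Proof.
move=> xy xy'; have [m [k E]] := horo_confluent hoY y y'.
have mk : m = k.
  have [hy _ _] := match_par xy; have [hy' _ _] := match_par xy'.
  have := congr1 hY E; rewrite !(horo_iter _ _ hoY) -hy -hy'; lia.
subst k; elim: m => [|m IH] in x y y' xy xy' E *; first exact: E.
have [_ pxy [c [xE yE]]] := match_par xy; have [_ pxy' [c' [xE' yE']]] := match_par xy'.
have py : pY y = pY y' by apply: IH pxy pxy' _; rewrite -!iterSr.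
rewrite yE yE' py; congr (t _ _).
by apply: (@sI (pX x)); rewrite -xE -xE'.
Qed.

End Match.

Lemma horo_match_sym X Y pX pY (oX : X) (oY : Y) s t x y :
  horo_match pX pY oX oY s t x y -> horo_match pY pX oY oX t s y x.
Proof. by elim=> [m|x' y' c _ IH]; [apply: match_root | apply: match_child]. Qed.

(** The matching is total and functional in both directions. *)
Theorem horotree_iso X Y pX pY (hX : X -> int) (hY : Y -> int) oX oY :
  horotree C pX hX oX -> horotree C pY hY oY ->
  exists f : X -> Y, [/\ bijective f, forall x, hY (f x) = hX x &
                         forall x, f (pX x) = pY (f x)].
Proof.
move=> hoX hoY; have [s [sI sP s0]] := horo_labelling hoX.
have [t [tI tP t0]] := horo_labelling hoY.
have /choice[f fP] := match_total pY oY t hoX sP.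
have /choice[g gP] := match_total pX oX s hoY tP.
have funX := match_functional hoX hoY sP tP sI s0 t0.
have funY := match_functional hoY hoX tP sP tI t0 s0.
exists f; split.
- exists g => [x|y]; first by apply: funY (gP _) (horo_match_sym (fP x)).
  by apply: funX (fP _) (horo_match_sym (gP y)).
- by move=> x; have [] := match_par hoX hoY sP tP s0 t0 (fP x).
move=> x; have [_ pxy _] := match_par hoX hoY sP tP s0 t0 (fP x).
exact: funX (fP _) pxy.
Qed.

End HorotreeIso.

(** * Places of the ring of Laurent polynomials in the t + l_i *)

Section Places.
Variables (L : comUnitRingType) (n : nat) (l : 'I_n -> L).
Hypothesis l_unit : forall i j, i != j -> l i - l j \is a GRing.unit.

Local Notation R := (locring l).
Local Notation inj := (Localization.inj l).
Local Notation den := (Localization.den l).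
Local Notation denadd := (@Localization.denadd n).
Local Notation den0 := (Localization.den0 n).
Local Notation cst := (Defs.cst l).
Local Notation place := (option 'I_n).
Implicit Types (P Q : R) (p : {poly L}) (k : {ffun 'I_n -> nat})
  (c : 'I_n -> int).

(** The value 1 at [None], the place at infinity, makes all the generators quotients
of the same form ([affgen]). *)
Definition tau_poly i : {poly L} := if i is Some i then 'X + (l i)%:P else 1.
Definition tau i : R := inj (tau_poly i).
Definition monom c : R := \prod_i tl l i ^ c i.
(** The order of vanishing of the monomial with exponents [c]; at infinity it is
minus the degree.  The levels at all places have sum 0, like the heights of a
vertex of the Diestel-Leader graph. *)
Definition level c i : int := if i is Some i then c i else - \sum_j c j.

Definition den1 (i : 'I_n) : {ffun 'I_n -> nat} := [ffun j => (j == i) : nat].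

Lemma den_den1 (i : 'I_n) : den (den1 i) = 'X + (l i)%:P.
Proof.
rewrite /Localization.den (bigD1 i) //= ffunE eqxx expr1 big1 ?mulr1 // => j ji.
by rewrite ffunE (negPf ji).
Qed.

Lemma sum_den1 (i : 'I_n) : (\sum_j den1 i j = 1)%N.
Proof.
rewrite (bigD1 i) //= ffunE eqxx big1 // => j ji.
by rewrite ffunE (negPf ji).
Qed.

Lemma tl_unit (i : 'I_n) : tl l i \is a GRing.unit.
Proof. by rewrite /tl -den_den1; apply: Localization.inj_den_unit. Qed.

Lemma tau_unit i : tau i \is a GRing.unit.
Proof. by case: i => [i|]; [apply: tl_unit | rewrite /tau rmorph1 unitr1]. Qed.

Lemma monom_unit c : monom c \is a GRing.unit.
Proof. by apply: rpred_prod => i _; rewrite unitrXz // tl_unit. Qed.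

Lemma monomD c c' : monom (fun i => c i + c' i) = monom c * monom c'.
Proof. by rewrite /monom -big_split; apply: eq_bigr => i _; rewrite exprzDr // tl_unit. Qed.

Lemma monomN c : monom (fun i => - c i) = (monom c)^-1.
Proof.
apply: (mulrI (monom_unit c)); rewrite -monomD divrr ?monom_unit // /monom big1 // => i _.
by rewrite subrr expr0z.
Qed.

Lemma monom0 : monom (fun=> 0) = 1.
Proof. by rewrite /monom big1 // => i _; rewrite expr0z. Qed.

Lemma eq_monom c c' : c =1 c' -> monom c = monom c'.
Proof. by move=> cc'; apply: eq_bigr => i _; rewrite cc'. Qed.

Lemma monom_den k : monom (fun i => (k i)%:Z) = inj (den k).
Proof. by rewrite /Localization.den rmorph_prod; apply: eq_bigr => i _; rewrite rmorphXn. Qed.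

Lemma levelD c c' i : level (fun a => c a + c' a) i = level c i + level c' i.
Proof. by case: i => //=; rewrite big_split opprD. Qed.

Lemma levelN c i : level (fun a => - c a) i = - level c i.
Proof. by case: i => //=; rewrite sumrN. Qed.

Lemma levelZ m c i : level (fun a => m * c a) i = m * level c i.
Proof. by case: i => //=; rewrite -mulr_sumr mulrN. Qed.

Lemma level0 i : level (fun=> 0) i = 0.
Proof. by case: i => //=; rewrite big1 ?oppr0. Qed.

(** The exponents of [tau i / tau j]: one unit of level moves from j to i. *)
Definition transfer i j : 'I_n -> int := fun a => (Some a == i)%:Z - (Some a == j)%:Z.

Lemma sum_place (i : place) : \sum_a (Some a == i)%:Z = 1 - (None == i)%:Z.
Proof.
case: i => [i|]; last by rewrite big1 ?subrr.
by rewrite (bigD1 i) //= eqxx big1 => // j ji; rewrite (inj_eq (@Some_inj _)) (negPf ji).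
Qed.

Lemma level_transfer i j i' : level (transfer i j) i' = (i' == i)%:Z - (i' == j)%:Z.
Proof.
case: i' => //=; rewrite sumrB !sum_place; ring.
Qed.

Lemma monom_place i : monom (fun a => (Some a == i)%:Z) = tau i.
Proof.
case: i => [i|]; last by rewrite /tau rmorph1 monom0.
rewrite /monom (bigD1 i) //= eqxx expr1z big1 ?mulr1 // => j ji.
by rewrite (inj_eq (@Some_inj _)) (negPf ji) expr0z.
Qed.

Lemma monom_transfer i j : monom (transfer i j) = tau i / tau j.
Proof. by rewrite /transfer monomD monomN !monom_place. Qed.

Lemma size_den k : size (den k) = (\sum_i k i).+1.
Proof.
rewrite /Localization.den; elim: (index_enum _) => [|i r IH].
  by rewrite !big_nil size_polyC oner_eq0.
have mon (r' : seq 'I_n) : \prod_(i <- r') ('X + (l i)%:P) ^+ k i \is monic.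
  by apply: monic_prod => j _; apply: monic_exp; rewrite monicXaddC.
rewrite !big_cons; elim: (k i) => [|m IHm]; first by rewrite mul1r IH.
rewrite exprS -mulrA size_monicM ?monicXaddC ?IHm ?size_XaddC //.
by apply: monic_neq0; rewrite monicMl ?mon // monic_exp // monicXaddC.
Qed.

Lemma size_mul_den p k : (size (p * den k)%R <= size p + \sum_i k i)%N.
Proof. by apply: leq_trans (size_polyMleq _ _) _; rewrite size_den addnS. Qed.

Lemma coef_den k : (den k)`_(\sum_i k i) = 1.
Proof.
by have /monicP := Localization.den_monic l k; rewrite lead_coefE size_den.
Qed.

(** Here the invertibility of the differences of the [l i] enters. *)
Lemma horner_den_unit k (i : 'I_n) : k i = 0%N -> (den k).[- l i] \is a GRing.unit.
Proof.
move=> ki; rewrite horner_prod; apply: rpred_prod => j _.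
rewrite horner_exp hornerD hornerX hornerC addrC.
have [->|ji] := eqVneq j i; first by rewrite ki unitr1.
by rewrite unitrX // l_unit.
Qed.

Lemma horner_den0 k (i : 'I_n) : (0 < k i)%N -> (den k).[- l i] = 0.
Proof.
move=> ki; rewrite horner_prod (bigD1 i) //= horner_exp hornerD hornerX hornerC.
by rewrite addNr expr0n; case: (k i) ki => //= m _; rewrite mul0r.
Qed.

Lemma root_factor p (i : 'I_n) : p.[- l i] = 0 -> exists q, p = q * ('X + (l i)%:P).
Proof. by move=> /rootP/factor_theorem[q ->]; exists q; rewrite polyCN opprK. Qed.

(** Elements without pole at [- l i]; at infinity, elements of negative degree,
since [size p] is the degree plus one and the denominator has degree \sum_j k j.
The strict bound at infinity leaves only 0 in the intersection over all places
([integral_cap]). *)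
Definition integral_at i P := exists p k,
  (if i is Some i then k i = 0%N else (size p <= \sum_j k j)%N) /\ P * inj (den k) = inj p.

Lemma integral_poly i p : i != None -> integral_at i (inj p).
Proof.
case: i => // i _; exists p, den0; split; first by rewrite ffunE.
by rewrite Localization.den_den0 rmorph1 mulr1.
Qed.

Lemma integral_0 i : integral_at i 0.
Proof.
exists 0, den0; split; last by rewrite mul0r rmorph0.
by case: i => [i|]; rewrite ?ffunE ?size_poly0.
Qed.

Lemma integral_opp i P : integral_at i P -> integral_at i (- P).
Proof.
move=> [p [k [ok E]]]; exists (- p), k; split; last by rewrite mulNr E rmorphN.
by case: i ok => // ok; rewrite size_polyN.
Qed.

Lemma sum_denadd k k' : (\sum_i denadd k k' i = \sum_i k i + \sum_i k' i)%N.
Proof. by rewrite -big_split; apply: eq_bigr => i _; rewrite ffunE. Qed.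

Lemma integral_add i P Q : integral_at i P -> integral_at i Q -> integral_at i (P + Q).
Proof.
move=> [p [k [okp Ep]]] [q [m [okq Eq]]].
exists (p * den m + q * den k), (denadd k m); split; last first.
  by rewrite Localization.den_add rmorphM rmorphD !rmorphM /= -Ep -Eq; ring.
case: i okp okq => [i|] okp okq; first by rewrite ffunE okp okq.
rewrite sum_denadd; apply: leq_trans (size_polyD _ _) _; rewrite geq_max.
have := size_mul_den p m; have := size_mul_den q k; lia.
Qed.

Lemma integral_sub i P Q : integral_at i P -> integral_at i Q -> integral_at i (P - Q).
Proof. by move=> nP nQ; apply: integral_add nP (integral_opp nQ). Qed.

Lemma integral_sum (I : finType) (A : pred I) (F : I -> R) i :
  (forall a, A a -> integral_at i (F a)) -> integral_at i (\sum_(a | A a) F a).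
Proof. by move=> NF; elim/big_ind: _ => //; [apply: integral_0 | apply: integral_add]. Qed.

Definition cpos c : {ffun 'I_n -> nat} := [ffun i => if c i is Posz m then m else 0%N].
Definition cneg c : {ffun 'I_n -> nat} := [ffun i => if c i is Negz m then m.+1 else 0%N].

Lemma cpos_cneg c i : c i = (cpos c i)%:Z - (cneg c i)%:Z.
Proof. by rewrite !ffunE; case: (c i) => m; rewrite ?subr0 ?sub0r ?NegzE. Qed.

Lemma monom_cpos c : monom c * inj (den (cneg c)) = inj (den (cpos c)).
Proof. by rewrite -!monom_den -monomD; apply: eq_monom => i; rewrite (cpos_cneg c) subrK. Qed.

(** A monomial of nonnegative level at a place has no pole there.  In particular
monomials of level 0 at i act on [integral_at i], so that [fil] depends on a
monomial only through its level. *)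
Lemma integral_mono c i P : 0 <= level c i -> integral_at i P -> integral_at i (P * monom c).
Proof.
move=> c_ge0 [p [k [ok E]]]; exists (p * den (cpos c)), (denadd k (cneg c)).
split; last by rewrite Localization.den_add !rmorphM /= -E -monom_cpos; ring.
case: i c_ge0 ok => [i|] /= c_ge0 ok.
  by rewrite !ffunE ok; case: (c i) c_ge0.
have cE : \sum_i c i = (\sum_i cpos c i)%N%:Z - (\sum_i cneg c i)%N%:Z.
  rewrite (eq_bigr _ (fun i _ => cpos_cneg c i)) sumrB.
  by rewrite !(big_morph Posz PoszD (erefl _)).
rewrite cE oppr_ge0 subr_le0 lez_nat in c_ge0; rewrite sum_denadd.
  exact: leq_trans (size_mul_den p _) (leq_add ok c_ge0).
Qed.

Lemma integral_tau b i j : i != j -> integral_at i (cst b / tau j).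
Proof.
case: j => [j|] ij; last first.
  by rewrite /tau rmorph1 divr1; apply: integral_poly.
exists b%:P, (den1 j); split; last by rewrite den_den1 divrK ?tau_unit.
case: i ij => [i|] ij.
  by rewrite ffunE; move: ij; rewrite (inj_eq (@Some_inj _)) => /negPf ->.
by rewrite sum_den1 size_polyC_leq1.
Qed.

(** At a finite place b is the value of [P * tau j] at [- l i], where the
denominator is a unit, and the difference gets divisible by [tau i].  At infinity
[P * tau j] has degree at most 0 and b is its coefficient of degree 0. *)
Lemma integral_digit i j P : i != j -> integral_at i P ->
  exists b, integral_at i ((P * tau j - cst b) / tau i).
Proof.
move=> ij [p [k [ok E]]].
have Eb b : (P * tau j - cst b) * inj (den k) = inj (p * tau_poly j - b%:P * den k).
  by rewrite rmorphB !rmorphM /= -E /tau /Defs.cst; ring.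
case: i ij ok => [i|] ij ok.
  exists ((p * tau_poly j).[- l i] / (den k).[- l i]); set b := (_.[_] / _).
  have [|q qE] := @root_factor (p * tau_poly j - b%:P * den k) i.
    by rewrite hornerD hornerN [X in _ - X]hornerM hornerC divrK ?subrr ?horner_den_unit.
  exists q, k; split=> //; apply: (mulIr (tau_unit (Some i))).
  by rewrite mulrAC divrK ?tau_unit // Eb qE rmorphM.
case: j ij Eb => // j _ Eb; exists (p * tau_poly (Some j))`_(\sum_i k i).
set b := _`_ _; exists (p * tau_poly (Some j) - b%:P * den k), k; split; last first.
  by rewrite -Eb /tau rmorph1 divr1.
apply/leq_sizeP => m; rewrite leq_eqVlt coefB coefCM => /predU1P[<-|km].
  by rewrite coef_den mulr1 subrr.
rewrite !nth_default ?mulr0 ?subrr // ?size_den //.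
apply: leq_trans km; have := size_mul_den p (den1 j); rewrite den_den1 sum_den1.
by move=> /leq_trans -> //; rewrite addn1 ltnS.
Qed.

Lemma integral_digit0 i b : integral_at i (cst b / tau i) -> b = 0.
Proof.
move=> [p [k [ok E]]]; case: i ok E => [i|] ok E.
  have : b%:P * den k = p * ('X + (l i)%:P).
    apply: (@Localization.inj_injective _ _ l); rewrite !rmorphM /= -E -/(tau (Some i)).
    by rewrite mulrAC divrK ?tau_unit.
  move=> /(congr1 (fun p => p.[- l i])); rewrite hornerM hornerC hornerM hornerD.
  rewrite hornerX hornerC addNr mulr0.
  by move=> b0; apply: (mulIr (horner_den_unit ok)); rewrite b0 mul0r.
have : b%:P * den k = p.
  apply: (@Localization.inj_injective _ _ l); rewrite !rmorphM /= -E.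
  by rewrite /tau rmorph1 divr1.
move=> /(congr1 (fun p => p`_(\sum_i k i))); rewrite coefCM coef_den mulr1 => ->.
by rewrite nth_default.
Qed.

(** An element without poles is a polynomial: as long as its denominator contains a
factor 'X + l i, the numerator vanishes at [- l i] and the factor cancels.  A
polynomial of negative degree is zero. *)
Lemma integral_cap P : (forall i, integral_at i P) -> P = 0.
Proof.
move=> NP; suff [p PE] : exists p, P = inj p.
  have [p' [k [ok]]] := NP None; rewrite PE -rmorphM => /Localization.inj_injective pE.
  have [->|p0] := eqVneq p 0; first by rewrite rmorph0.
  move: ok; rewrite -pE size_Mmonic ?Localization.den_monic // size_den.
  by rewrite addnS /= -[leqRHS]add0n leq_add2r leqn0 size_poly_eq0 (negPf p0).
have [p [k PE]] := Localization.fracE P.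
have {PE} : P * inj (den k) = inj p by rewrite PE divrK // Localization.inj_den_unit.
(* Induction on the degree of the denominator. *)
have [m] := ubnP (\sum_i k i)%N; elim: m => // m IH in p k *.
have [k0 _|/forallPn[i]] := boolP [forall i, k i == 0%N].
  have -> : k = den0 by apply/ffunP => i; rewrite ffunE; apply/eqP/(forallP k0).
  by rewrite Localization.den_den0 rmorph1 mulr1 => ->; exists p.
rewrite -lt0n => ki km E.
have [p' [k' [k'i E']]] := NP (Some i).
have EE : p * den k' = p' * den k.
  by apply: (@Localization.inj_injective _ _ l); rewrite !rmorphM /= -E -E'; ring.
have [q pE] : exists q, p = q * ('X + (l i)%:P).
  apply: root_factor; apply: (mulIr (horner_den_unit k'i)).
  by rewrite mul0r -[LHS]hornerM EE hornerM (horner_den0 ki) mulr0.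
have kE : k = denadd [ffun j => k j - den1 i j]%N (den1 i).
  by apply/ffunP => j; rewrite !ffunE; case: eqP => [->|_]; rewrite ?addn0 ?subn0 // subnK.
apply: (IH q [ffun j => k j - den1 i j]%N).
  by move: km; rewrite {1}kE sum_denadd sum_den1; lia.
apply: (mulIr (tl_unit i)); rewrite -[RHS]rmorphM /= -pE -E [in RHS]kE.
by rewrite Localization.den_add den_den1 rmorphM mulrA.
Qed.

End Places.

(** * Filtrations and trees of balls *)

Section Filtration.
Variables (L : comUnitRingType) (n : nat) (l : 'I_n -> L).
Hypothesis l_unit : forall i j, i != j -> l i - l j \is a GRing.unit.
Hypothesis n_gt0 : (0 < n)%N.

Local Notation R := (locring l).
Local Notation inj := (Localization.inj l).
Local Notation den := (Localization.den l).
Local Notation cst := (Defs.cst l).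
Local Notation place := (option 'I_n).
Local Notation tau := (tau l).
Local Notation monom := (monom l).
Implicit Types (P Q : R) (c : 'I_n -> int).

Lemma other_place (i : place) : exists j, j != i.
Proof. by case: i => [i|]; [exists None | exists (Some (Ordinal n_gt0))]. Qed.

Lemma integral_exh (i : place) P : exists c, integral_at i (P / monom c).
Proof.
have [p [k PE]] := Localization.fracE P.
case: i => [i|].
  exists (fun a => - (k a)%:Z).
  rewrite monomN invrK monom_den PE divrK ?Localization.inj_den_unit //.
  exact: integral_poly.
pose m : {ffun 'I_n -> nat} := [ffun=> size p].
exists (fun a => (m a)%:Z), p, (Localization.denadd k m); split.
  have mE : (\sum_a m a = n * size p)%N.
    by rewrite (eq_bigr (fun=> size p)) => [|a _]; rewrite ?ffunE // sum_nat_const card_ord.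
  by rewrite sum_denadd mE; apply: leq_trans (leq_addl _ _); rewrite leq_pmull.
rewrite monom_den Localization.den_add rmorphM /= PE mulrCA.
by rewrite divrK ?Localization.inj_den_unit // mulrC divrK ?Localization.inj_den_unit.
Qed.

(** The elements that vanish to order at least h at the place i, or, at infinity,
that have degree less than - h.  All the monomials of level h serve as local
parameters, and give the same condition ([fil_level]). *)
Definition fil (i : place) (h : int) P := exists c, level c i = h /\ integral_at i (P / monom c).

Lemma fil_level c i P : fil i (level c i) P <-> integral_at i (P / monom c).
Proof.
split=> [[c' [cc' NP]]|NP]; last by exists c.
have -> : P / monom c = P / monom c' * monom (fun a => c' a + - c a).
  by rewrite monomD monomN mulrA divrK ?monom_unit.
by apply: integral_mono NP => //; rewrite levelD levelN cc' subrr.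
Qed.

Lemma level_surj (i : place) h : exists c, level c i = h.
Proof.
have [j ji] := other_place i.
exists (fun a => h * transfer i j a).
by rewrite levelZ level_transfer eqxx eq_sym (negPf ji) subr0 mulr1.
Qed.

Lemma fil_le i h h' P : h' <= h -> fil i h P -> fil i h' P.
Proof.
have [c' <-] := level_surj i h'; move=> lehh' [c [cE NP]]; apply/fil_level.
have -> : P / monom c' = P / monom c * monom (fun a => c a + - c' a).
  by rewrite monomD monomN mulrA divrK ?monom_unit.
by apply: integral_mono NP => //; rewrite levelD levelN cE subr_ge0.
Qed.

Lemma fil_0 i h : fil i h 0.
Proof. by have [c <-] := level_surj i h; apply/fil_level; rewrite mul0r; apply: integral_0. Qed.

Lemma fil_sub i h P Q : fil i h P -> fil i h Q -> fil i h (P - Q).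
Proof.
have [c <-] := level_surj i h => /fil_level NP /fil_level NQ; apply/fil_level.
by rewrite mulrBl; apply: integral_sub.
Qed.

Lemma fil_opp i h P : fil i h P -> fil i h (- P).
Proof. by rewrite -sub0r => MP; apply: fil_sub (fil_0 _ _) MP. Qed.

Lemma fil_add i h P Q : fil i h P -> fil i h Q -> fil i h (P + Q).
Proof. by move=> MP MQ; rewrite -[Q]opprK; apply: fil_sub MP (fil_opp MQ). Qed.

Lemma fil_exh i P : exists h, fil i h P.
Proof. by have [c NP] := integral_exh i P; exists (level c i), c. Qed.

(** Expresses the passage from level h to level h + 1 by the division with
remainder of [integral_digit]. *)
Lemma digit_shift c (i j : place) P b :
  (P - cst b * monom c / tau j) / monom (fun a => c a + transfer i j a) =
  (P / monom c * tau j - cst b) / tau i.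
Proof.
rewrite monomD monom_transfer !invrM ?unitrMl ?unitrV ?tau_unit ?monom_unit // invrK.
transitivity (P / monom c * tau j / tau i - cst b * (monom c / monom c) * (tau j / tau j) / tau i).
  ring.
by rewrite !divrr ?monom_unit ?tau_unit // !mulr1 mulrBl.
Qed.

Lemma level_transfer_up c (i j : place) : i != j ->
  level (fun a => c a + transfer i j a) i = level c i + 1.
Proof. by move=> /negPf ij; rewrite levelD level_transfer eqxx ij subr0. Qed.

Lemma level_transfer_down c (i j : place) : i != j ->
  level (fun a => c a + transfer i j a) j = level c j - 1.
Proof. by move=> ij; rewrite levelD level_transfer eqxx eq_sym (negPf ij) sub0r. Qed.

Lemma level_transfer_other c (i j a : place) : a != i -> a != j ->
  level (fun a => c a + transfer i j a) a = level c a.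
Proof. by move=> /negPf ai /negPf aj; rewrite levelD level_transfer ai aj subrr addr0. Qed.

(** With [fil_digit0]: the quotient of two successive steps of the filtration is a
copy of L. *)
Lemma fil_digit c (i j : place) P : i != j -> fil i (level c i) P ->
  exists b, fil i (level c i + 1) (P - cst b * monom c / tau j).
Proof.
move=> ij /fil_level/(integral_digit l_unit ij)[b Nb]; exists b.
by rewrite -(level_transfer_up _ ij); apply/fil_level; rewrite digit_shift.
Qed.

Lemma fil_digit0 c (i j : place) b : i != j ->
  fil i (level c i + 1) (cst b * monom c / tau j) -> b = 0.
Proof.
move=> ij Mb; apply: (@integral_digit0 _ _ l l_unit i).
have := fil_opp Mb; rewrite -(level_transfer_up _ ij) => /fil_level.
by rewrite -sub0r digit_shift mul0r mul0r sub0r mulNr => /integral_opp; rewrite opprK.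
Qed.

(** With [fil_gen1]: adding b u / tau j changes no ball of the vertex (u, P) at a
place other than j, nor the parent of its ball at j. *)
Lemma fil_gen c (i j : place) b : i != j -> fil i (level c i) (cst b * monom c / tau j).
Proof.
move=> ij; apply/fil_level; rewrite mulrAC mulrK ?monom_unit //.
exact: integral_tau.
Qed.

Lemma fil_gen1 c (j : place) b : fil j (level c j - 1) (cst b * monom c / tau j).
Proof.
have [i ij] := other_place j.
rewrite -(level_transfer_down _ ij); apply/fil_level.
(* digit_shift is used with P = 0, hence up to sign. *)
rewrite -[X in X / _]opprK -[X in - X]sub0r mulNr digit_shift !mul0r sub0r mulNr opprK.
by apply: integral_tau; rewrite eq_sym.
Qed.

Lemma fil_cap c P : (forall i, fil i (level c i) P) -> P = 0.
Proof.
move=> MP; apply: (mulIr (monom_unit l (fun a => - c a))); rewrite mul0r monomN.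
by apply: (integral_cap l_unit) => i; apply/fil_level.
Qed.

(** If the levels differed at i, the element u / tau j would be zero modulo the next
step of the filtration at i, against [fil_digit0] for b = 1. *)
Lemma monom_inj c c' : monom c = monom c' -> level c =1 level c'.
Proof.
move=> Ucc' i; have [j ji] := other_place i; rewrite eq_sym in ji.
have key c1 c2 : monom c1 = monom c2 -> level c1 i < level c2 i -> False.
  move=> U12 lt12; suff : (1 : L) = 0 by apply/eqP/oner_neq0.
  apply: (@fil_digit0 c1 i j 1 ji); rewrite U12.
  apply: fil_le (fil_gen c2 1 ji); lia.
by case: (ltgtP (level c i) (level c' i)) => // H; case: (key _ _ _ H).
Qed.

(** P has the principal part of Q at i and no pole elsewhere.  It is built digit by
digit from the pole of Q at i, with the powers of [tau i / tau j] for a fixed j as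
local parameters. *)
Lemma local_approx (i : place) Q :
  exists P, integral_at i (P - Q) /\ forall j, j != i -> integral_at j P.
Proof.
have [m] : exists m : nat, fil i (- m%:Z) Q.
  have [h MQ] := fil_exh i Q; exists `|h|%N.
  by apply: fil_le MQ; lia.
elim: m Q => [|m IH] Q MQ.
  exists 0; split; last by move=> *; apply: integral_0.
  rewrite sub0r; apply: integral_opp.
  have /fil_level : fil i (level (fun=> 0) i) Q by rewrite level0.
  by rewrite monom0 divr1.
have [j ji] := other_place i; have ij : i != j by rewrite eq_sym.
(* The leading digit b of the pole of order m + 1 is removed from Q. *)
pose c a := - m.+1%:Z * transfer i j a.
have cE a : level c a = - m.+1%:Z * ((a == i)%:Z - (a == j)%:Z) by rewrite levelZ level_transfer.
have ci : level c i = - m.+1%:Z by rewrite cE eqxx (negPf ij) subr0 mulr1.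
rewrite -ci in MQ; have [b] := fil_digit ij MQ.
have -> : level c i + 1 = - m%:Z by rewrite ci; lia.
move=> /IH[P [NP NjP]]; exists (P + cst b * monom c / tau j); split.
  by move: NP; rewrite opprB addrA.
move=> a ai; apply: integral_add; first exact: NjP.
have -> : cst b * monom c / tau j = cst b / tau i * monom (fun a => c a + transfer i j a).
  rewrite monomD monom_transfer.
  transitivity (cst b * monom c / tau j * (tau i / tau i)); last by ring.
  by rewrite divrr ?tau_unit ?mulr1.
apply: integral_mono (integral_tau _ _ ai).
rewrite levelD level_transfer cE (negPf ai); case: (a == j); lia.
Qed.

Lemma fil_crt c (Q : place -> R) : exists P, forall i, fil i (level c i) (P - Q i).
Proof.
have [F FP] := choice (fun i => local_approx i (Q i / monom c)).
exists ((\sum_i F i) * monom c) => i; apply/fil_level; rewrite mulrBl mulrK ?monom_unit //.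
rewrite (bigD1 i) //= addrAC; apply: integral_add; first by case: (FP i).
by apply: integral_sum => j ji; case: (FP j) => _; apply; rewrite eq_sym.
Qed.

End Filtration.

Section Balls.
Variables (L : comUnitRingType) (n : nat) (l : 'I_n -> L).
Hypothesis l_unit : forall i j, i != j -> l i - l j \is a GRing.unit.
Hypothesis n_gt0 : (0 < n)%N.
Variable i : option 'I_n.

Local Notation R := (locring l).
Local Notation fil := (@fil L n l i).
Implicit Types (P Q : R).

(** A ball is a height together with a coset; as the center is not recorded, equal
balls are equal elements of this type. *)
Definition ball : Type :=
  {x : int * set R | exists P, x.2 = [set Q | fil x.1 (Q - P)]%classic}.

Definition Ball h P : ball := exist _ (h, [set Q | fil h (Q - P)]%classic) (ex_intro _ P erefl).

Lemma BallE h P h' P' : Ball h P = Ball h' P' <-> h = h' /\ fil h (P - P').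
Proof.
split=> [[<- E]|[<- MP]].
  split=> //; have : [set Q | fil h (Q - P)]%classic P by rewrite /= subrr; apply: fil_0.
  by rewrite E.
apply: eq_exist => /=; congr (_, _); apply/seteqP; split=> Q /= MQ.
  by rewrite -(subrK P Q) -addrA; apply: fil_add.
by rewrite -(subrK P' Q) -addrA -[P' - P]opprB; apply: fil_sub.
Qed.

Lemma BallP (x : ball) : exists P, x = Ball (sval x).1 P.
Proof.
case: x => [[h A] /= AE]; have [P /= PE] := AE; exists P.
by apply: eq_exist; rewrite /= PE.
Qed.

Definition ball_height (x : ball) : int := (sval x).1.

Definition ball_par (x : ball) : ball := Ball (ball_height x - 1) (sval (cid (BallP x))).

Lemma ball_par_Ball h P : ball_par (Ball h P) = Ball (h - 1) P.
Proof.
rewrite /ball_par; case: cid => /= Q /BallE[_ MPQ]; apply/BallE; split=> //.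
by rewrite -[Q - P]opprB; apply: (fil_opp n_gt0); apply: (fil_le n_gt0 _ MPQ); rewrite gerBl.
Qed.

Lemma iter_ball_par m h P : iter m ball_par (Ball h P) = Ball (h - m%:Z) P.
Proof.
elim: m => [|m IH]; first by rewrite subr0.
by rewrite iterS IH ball_par_Ball -addn1 PoszD; congr (Ball _ _); ring.
Qed.

Theorem ball_horotree : horotree L ball_par ball_height (Ball 0 0).
Proof.
split=> //.
- move=> x y; have [P ->] := BallP x; have [Q ->] := BallP y.
  set h := (_.1); set h' := (_.1); have [g Mg] := fil_exh n_gt0 i (P - Q).
  (* Below both heights and the order of P - Q, the two balls have one ancestor. *)
pose g' : int := Num.min g (Num.min h h').
  exists `|h - g'|%N, `|h' - g'|%N; rewrite !iter_ball_par; apply/BallE.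
  have g'h : h - `|h - g'|%N%:Z = g' by rewrite /g'; lia.
  rewrite g'h; split; first by rewrite /g'; lia.
  by apply: fil_le Mg => //; rewrite /g'; lia.
move=> x; have [P ->] := BallP x; set h := (_.1).
have [c ch] := level_surj n_gt0 i h; have [j ji] := other_place n_gt0 i.
have ij : i != j by rewrite eq_sym.
exists (fun b => Ball (h + 1) (P + Defs.cst l b * monom l c / tau l j)); split.
  move=> b b' /BallE[_]; rewrite -ch opprD addrACA subrr add0r -!mulrBl -rmorphB -rmorphB.
  by move=> /(fil_digit0 l_unit n_gt0 ij)/eqP; rewrite subr_eq0 => /eqP.
move=> y; split=> [|[b ->]]; last first.
  rewrite ball_par_Ball addrK; apply/BallE; split=> //.
  by rewrite addrAC subrr add0r -ch; apply: fil_gen.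
have [Q ->] := BallP y; rewrite ball_par_Ball => /BallE[hE MQ].
rewrite hE -ch in MQ; have [b Mb] := fil_digit l_unit ij MQ.
exists b; apply/BallE; rewrite -hE subrK; split=> //.
by move: Mb; rewrite ch -hE subrK opprD addrA.
Qed.

End Balls.

(** * The affine group and its generators *)

Section Group.
Variables (L : finComUnitRingType) (n : nat) (l : 'I_n -> L).
Hypothesis n_gt0 : (0 < n)%N.

Local Notation R := (locring l).
Local Notation cst := (Defs.cst l).
Local Notation place := (option 'I_n).
Local Notation tau := (tau l).
Local Notation monom := (monom l).
Local Notation aff := (@aff L n l).
Implicit Types (P Q : R) (c : 'I_n -> int) (b : L).

Lemma affM (a : R) P (b : R) Q : aff a P * aff b Q = aff (a * b) (a * Q + P).
Proof.
apply/matrixP => i j; rewrite !mxE !big_ord_recl big_ord0 !mxE addr0.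
by case: i => [[|[|i]] //= ?]; case: j => [[|[|j]] //= ?];
  rewrite ?mulr0 ?mulr1 ?mul0r ?mul1r ?addr0 ?add0r.
Qed.

Lemma aff1 : aff 1 0 = 1.
Proof.
apply/matrixP => i j; rewrite !mxE.
by case: i => [[|[|i]] //= ?]; case: j => [[|[|j]] //= ?].
Qed.

Lemma aff_inj (a : R) P (b : R) Q : aff a P = aff b Q -> a = b /\ P = Q.
Proof.
move=> /matrixP E; have := E 0 0; have := E 0 1.
by rewrite !mxE.
Qed.

Lemma aff_unit (a : R) P : a \is a GRing.unit -> aff a P \is a GRing.unit.
Proof.
move=> ua; apply/unitrP; exists (aff a^-1 (- (a^-1 * P))).
by rewrite !affM mulVr // divrr // mulrN mulrA divrr // mul1r addNr subrr aff1.
Qed.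

Lemma affV (a : R) P : a \is a GRing.unit -> (aff a P)^-1 = aff a^-1 (- (a^-1 * P)).
Proof.
move=> ua; apply: (mulrI (aff_unit P ua)); rewrite divrr ?aff_unit // affM.
by rewrite divrr // mulrN mulrA divrr // mul1r addNr aff1.
Qed.

Lemma GammaP A : Gamma l A <-> exists c P, A = aff (monom c) P.
Proof. by []. Qed.

Lemma Gamma_subgroup : is_subgroup (Gamma l).
Proof.
split.
- by move=> A [c [P ->]]; apply/aff_unit/monom_unit.
- by exists (fun=> 0), 0; rewrite -[RHS]/(aff (monom (fun=> 0)) 0) monom0 aff1.
- move=> A B [c [P ->]] [c' [P' ->]]; rewrite affM -monomD.
  by exists (fun i => c i + c' i), (monom c * P' + P).
move=> A [c [P ->]]; rewrite affV -/(monom c) ?monom_unit // -monomN.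
by exists (fun i => - c i), (- (monom (fun i => - c i) * P)).
Qed.

(** The common form of the generators.  With [None] for j it is the generator with
diagonal entry [tl l i], and with [None] for i the inverse of such a generator. *)
Definition affgen (i j : place) b := aff (tau i / tau j) (cst b / tau j).

Lemma affgenV i j b : (affgen i j b)^-1 = affgen j i (- b).
Proof.
rewrite /affgen affV ?unitrMl ?unitrV ?tau_unit // invrM ?unitrV ?tau_unit // invrK.
congr aff; rewrite /Defs.cst polyCN rmorphN mulNr -/(cst b); congr (- _).
transitivity (cst b / tau i * (tau j / tau j)); first by ring.
by rewrite divrr ?tau_unit ?mulr1.
Qed.

Lemma Gamma_mul_affgen c P i j b :
  aff (monom c) P * affgen i j b =
  aff (monom (fun a => c a + transfer i j a)) (P + cst b * monom c / tau j).
Proof. by rewrite affM monomD monom_transfer; congr aff; ring. Qed.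

(** The signs of the translation parts are absorbed by b. *)
Lemma Gamma_gensE A :
  Gamma_gens l A <-> exists i j b, i != j /\ A = affgen i j b.
Proof.
have g1 i b : aff (tl l i) (cst b) = affgen (Some i) None b.
  by rewrite /affgen {2 3}/tau rmorph1 !divr1.
split=> [[[i [b [->|->]]]|[i [j [b [ij ->]]]]]|[i [j [b [ij ->]]]]].
- by exists (Some i), None, b; rewrite g1.
- by exists None, (Some i), (- b); rewrite g1 affgenV.
- exists (Some i), (Some j), (- b); split; first by rewrite (inj_eq (@Some_inj _)).
  by rewrite /affgen /Defs.cst polyCN rmorphN mulNr.
case: i j ij => [i|] [j|] ij //.
- right; exists i, j, (- b); split; first by move: ij; rewrite (inj_eq (@Some_inj _)).
  by rewrite /affgen /Defs.cst polyCN rmorphN mulNr opprK.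
- by left; exists i, b; left; rewrite g1.
by left; exists j, (- b); right; rewrite g1 affgenV opprK.
Qed.

Section Generation.
Variable H : set 'M[R]_2.
Hypothesis Hsub : is_subgroup H.
Hypothesis Hgens : (Gamma_gens l `<=` H)%classic.

Let H1 : H 1. Proof. by case: Hsub. Qed.
Let HM A B : H A -> H B -> H (A * B). Proof. by case: Hsub => _ _ HM _; apply: HM. Qed.
Let HV A : H A -> H A^-1. Proof. by case: Hsub => _ _ _ HV; apply: HV. Qed.

Lemma subgroup_tl i b : H (aff (tl l i) (cst b)).
Proof. by apply: Hgens; left; exists i, b; left. Qed.

Lemma cst0 : cst 0 = 0. Proof. exact: rmorph0. Qed.

Lemma subgroup_diag c : H (aff (monom c) 0).
Proof.
rewrite -[monom c]/(\prod_i tl l i ^ c i); elim/big_ind: _ => [|a b Ha Hb|i _].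
- by rewrite aff1.
- by have := HM Ha Hb; rewrite affM mulr0 addr0.
have Htl : H (aff (tl l i) 0) by rewrite -cst0; apply: subgroup_tl.
have HX m : H (aff (tl l i ^+ m) 0).
  elim: m => [|m IH]; first by rewrite aff1.
  by have := HM Htl IH; rewrite affM mulr0 addr0 -exprS.
case: (c i) => m; first exact: HX.
by have := HV (HX m.+1); rewrite affV ?unitrX ?tl_unit // mulr0 oppr0.
Qed.

Lemma subgroup_translation_mul c P : H (aff 1 P) -> H (aff 1 (monom c * P)).
Proof.
move=> HP; have := HM (HM (subgroup_diag c) HP) (HV (subgroup_diag c)).
by rewrite affV ?monom_unit // !affM mulr1 mulr0 oppr0 mulr0 addr0 add0r divrr ?monom_unit.
Qed.

Lemma subgroup_translation_add P Q : H (aff 1 P) -> H (aff 1 Q) -> H (aff 1 (P + Q)).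
Proof. by move=> HP HQ; have := HM HQ HP; rewrite affM !mul1r. Qed.

(** The translation parts reached form an additive group that contains L and is
stable under multiplication by monomials.  By induction on the degree it contains
the multiples b p of a polynomial p, since
b (p t + a) = (t + l_0) b p - b l_0 p + b a,
and then all fractions, the denominators being monomials. *)
Lemma subgroup_translation P : H (aff 1 P).
Proof.
pose i0 := Ordinal n_gt0.
have Hcst b : H (aff 1 (cst b)).
  have := HM (subgroup_tl i0 b) (HV (subgroup_tl i0 0)).
  by rewrite cst0 affV ?tl_unit // affM mulr0 oppr0 mulr0 add0r divrr ?tl_unit.
have Hpoly p : forall b, H (aff 1 (cst b * Localization.inj l p)).
  elim/poly_ind: p => [|p a IH] b; first by rewrite rmorph0 mulr0 -cst0; apply: Hcst.
  have -> : cst b * Localization.inj l (p * 'X + a%:P) =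
      monom (fun a => (Some a == Some i0)%:Z) * (cst b * Localization.inj l p)
      + (cst (- (b * l i0)) * Localization.inj l p + cst (b * a)).
    rewrite monom_place -[tau _]/(tl l i0) /tl /Defs.cst /=.
    rewrite -!rmorphM -!rmorphD; congr (Localization.inj l _).
    by rewrite polyCN !polyCM; ring.
  apply: subgroup_translation_add; first exact: subgroup_translation_mul.
  exact: subgroup_translation_add.
have [p [k ->]] := Localization.fracE P.
rewrite mulrC -monom_den -monomN; apply: subgroup_translation_mul.
by rewrite -[X in aff 1 X]mul1r -(rmorph1 (Localization.inj l)); apply: Hpoly.
Qed.

Lemma Gamma_sub : (Gamma l `<=` H)%classic.
Proof.
move=> A [c [P ->]]; have := HM (subgroup_translation P) (subgroup_diag c).
by rewrite affM mulr0 add0r mul1r.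
Qed.

End Generation.

End Group.

Lemma Gamma_generating (L : finComUnitRingType) (n : nat) (l : 'I_n -> L) :
  (0 < n)%N -> is_generating_set (Gamma l) (Gamma_gens l).
Proof.
move=> n_gt0; split; last by move=> H; apply: Gamma_sub.
- apply: (@sub_finite_set _ _
    ((fun x : option 'I_n * option 'I_n * L => affgen l x.1.1 x.1.2 x.2) @` setT)%classic).
    by move=> A /Gamma_gensE[i [j [b [_ ->]]]]; exists (i, j, b).
  exact/finite_image/finite_finset.
- move=> A /Gamma_gensE[i [j [b [ij ->]]]]; apply/Gamma_gensE.
  by exists j, i, (- b); rewrite affgenV eq_sym.
move=> A /Gamma_gensE[i [j [b [ij ->]]]].
exists (transfer i j), (Defs.cst l b / tau l j).
by rewrite -/(monom l (transfer i j)) monom_transfer.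
Qed.

(** * The Diestel-Leader graph *)

Section DiestelLeader.
Variables (L : finComUnitRingType) (n : nat) (l : 'I_n -> L).
Hypothesis l_unit : forall i j, i != j -> l i - l j \is a GRing.unit.
Hypothesis n_gt0 : (0 < n)%N.
Variables (V : choiceType) (e : rel V) (omega : set (nat -> V)) (o : V) (par : V -> V).
Hypothesis eE : forall x y, e x y <-> par x = y \/ par y = x.
Hypothesis horoV : horotree L par (busemann e omega o) o.

Local Notation R := (locring l).
Local Notation cst := (Defs.cst l).
Local Notation tau := (tau l).
Local Notation monom := (monom l).
Local Notation aff := (@aff L n l).
Local Notation h := (busemann e omega o).
Local Notation DL := (DL_vertex e omega o n.+1).
Implicit Types (x y : DL) (i j k : 'I_n.+1) (A B : 'M[R]_2).

(** The coordinate 0 of the Diestel-Leader graph is the place at infinity. *)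
Definition place_of i : option 'I_n := unlift ord0 i.

Lemma place_ofK : cancel (oapp (lift ord0) ord0) place_of.
Proof. by case=> [a|]; [apply: liftK | apply: unlift_none]. Qed.

Lemma place_of_inj : injective place_of.
Proof. by rewrite /place_of => i j; case: unliftP => [a|] ->; case: unliftP => [b|] -> // [->]. Qed.

Definition exponent x : 'I_n -> int := fun a => h (val x (lift ord0 a)).

(** At infinity this holds because the heights of a vertex have sum 0. *)
Lemma level_exponent x i : level (exponent x) (place_of i) = h (val x i).
Proof.
rewrite /place_of; case: unliftP => [a|] -> //=.
have : \sum_(i < n.+1) h (val x i) = 0 := set_valP x.
rewrite big_ord_recl => /eqP.
by rewrite addr_eq0 => /eqP ->.
Qed.

Variable phi : forall p : option 'I_n, V -> ball l p.
Hypothesis phi_bij : forall p, bijective (@phi p).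
Hypothesis phi_height : forall p v, ball_height (phi p v) = h v.
Hypothesis phi_par : forall p v, phi p (par v) = ball_par (phi p v).

Let phi_inj p : injective (phi p). Proof. exact: bij_inj. Qed.

(** The matrix (u, P) represents x if u has the heights of x as levels and P lies in
all the balls of x. *)
Definition represents x A := exists P, A = aff (monom (exponent x)) P /\
  forall i, phi (place_of i) (val x i) = Ball (place_of i) (h (val x i)) P.

Lemma represents_total x : exists A, represents x A.
Proof.
have /choice[Q QE] (p : option 'I_n) : exists Q,
    phi p (val x (oapp (lift ord0) ord0 p)) = Ball p (h (val x (oapp (lift ord0) ord0 p))) Q.
  have [Q QE] := BallP (phi p (val x (oapp (lift ord0) ord0 p))).
  by exists Q; rewrite -(phi_height p); exact: QE.
have [P PQ] := fil_crt l_unit n_gt0 (exponent x) Q.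
exists (aff (monom (exponent x)) P), P; split=> // i.
have iE : oapp (lift ord0) ord0 (place_of i) = i by apply: place_of_inj; rewrite place_ofK.
have := QE (place_of i); rewrite iE => ->; apply/(BallE n_gt0); split=> //.
rewrite -[_ - P]opprB; apply: (fil_opp n_gt0).
by rewrite -level_exponent.
Qed.

Lemma represents_Gamma x A : represents x A -> Gamma l A.
Proof. by case=> P [-> _]; exists (exponent x), P. Qed.

Lemma represents_functional x A B : represents x A -> represents x B -> A = B.
Proof.
move=> [P [-> PE]] [Q [-> QE]]; congr aff; apply/eqP; rewrite -subr_eq0; apply/eqP.
apply: (fil_cap l_unit (c := exponent x)) => p; rewrite -(place_ofK p) level_exponent.
by have /(BallE n_gt0)[] := etrans (esym (PE (oapp (lift ord0) ord0 p))) (QE _).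
Qed.

Lemma represents_surj A : Gamma l A -> exists x, represents x A.
Proof.
move=> /GammaP[c [P ->]].
have /choice[v vE] i : exists v, phi (place_of i) v = Ball (place_of i) (level c (place_of i)) P.
  by have [psi _ phiK] := phi_bij (place_of i); eexists; apply: phiK.
have hv i : h (v i) = level c (place_of i) by rewrite -(phi_height (place_of i)) vE.
have xP : DL [ffun i => v i].
  rewrite /DL_vertex /= (eq_bigr (fun i => level c (place_of i))) => [|i _]; last by rewrite ffunE.
  rewrite big_ord_recl /place_of unlift_none /=.
  by rewrite [X in _ + X](eq_bigr c) ?addNr // => a _; rewrite liftK.
exists (SigSub (mem_set xP)); exists P; split=> [|i]; last by rewrite /= ffunE vE hv.
congr aff; apply: eq_monom => a.
by rewrite /exponent /= ffunE hv /place_of liftK.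
Qed.

Lemma represents_inj x y A : represents x A -> represents y A -> x = y.
Proof.
move=> [P [-> PE]] [Q [/aff_inj[EU EP] QE]]; subst Q.
apply/val_inj/ffunP => i; apply: (@phi_inj (place_of i)); rewrite PE QE.
by congr Ball; rewrite -!level_exponent (monom_inj l_unit n_gt0 EU).
Qed.

(** The coordinate i goes down to a child, and j up to its parent. *)
Definition dl_step x y i j := [/\ par (val y i) = val x i, par (val x j) = val y j &
  forall k, k != i -> k != j -> val x k = val y k].

(** Along an edge one coordinate goes to its parent and another to a child, as the
sum of the heights is preserved. *)
Lemma DL_adjE x y : DL_adj e omega o n.+1 x y <-> exists i j, i != j /\ dl_step x y i j.
Proof.
split=> [[i [j [ij ei ej E]]]|[i [j [ij [Ei Ej E]]]]]; last first.
  by exists i, j; split=> //; apply/eE; [right|left].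
(* The two moving coordinates cannot both go up, or both go down. *)
have sumE (z : DL) : h (val z i) + h (val z j) = - \sum_(k | (k != i) && (k != j)) h (val z k).
  have : \sum_(k < n.+1) h (val z k) = 0 := set_valP z.
  rewrite (bigD1 i) //= (bigD1 j) 1?eq_sym //= addrA => /eqP.
  by rewrite addr_eq0 => /eqP.
have {}sumE : h (val x i) + h (val x j) = h (val y i) + h (val y j).
  by rewrite !sumE; congr (- _); apply: eq_bigr => k /andP[ki kj]; rewrite E.
move: ei ej => /eE[ei|ei] /eE[ej|ej].
- have := horo_par horoV (val x i); have := horo_par horoV (val x j).
  by rewrite ei ej; move: sumE; lia.
- exists j, i; split; first by rewrite eq_sym.
  by split=> // k kj ki; apply: E.
- by exists i, j.
have := horo_par horoV (val y i); have := horo_par horoV (val y j).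
by rewrite ei ej; move: sumE; lia.
Qed.

Lemma place_of_neq i j : i != j -> place_of i != place_of j.
Proof. by rewrite (inj_eq place_of_inj). Qed.

Lemma affgen_dl_step x y A i j b : i != j -> represents x A ->
  represents y (A * affgen l (place_of i) (place_of j) b) -> dl_step x y i j.
Proof.
move=> /place_of_neq pij [P [-> PE]] [Q [+ QE]].
rewrite Gamma_mul_affgen => /aff_inj[/esym EU /esym EQ]; subst Q.
have hE k : h (val y k) =
    level (fun a => exponent x a + transfer (place_of i) (place_of j) a) (place_of k).
  by rewrite -level_exponent (monom_inj l_unit n_gt0 EU).
split.
- apply: (@phi_inj (place_of i)); rewrite phi_par PE QE ball_par_Ball //.
  rewrite hE level_transfer_up // level_exponent addrK; apply/(BallE n_gt0); split=> //.
  by rewrite addrAC subrr add0r -level_exponent; apply: fil_gen.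
- apply: (@phi_inj (place_of j)); rewrite phi_par PE QE ball_par_Ball //.
  rewrite hE level_transfer_down // level_exponent; apply/(BallE n_gt0); split=> //.
  by rewrite opprD addrA subrr add0r -level_exponent; apply/(fil_opp n_gt0)/fil_gen1.
move=> k /place_of_neq ki /place_of_neq kj; apply: (@phi_inj (place_of k)).
rewrite PE QE hE level_transfer_other // level_exponent; apply/(BallE n_gt0); split=> //.
by rewrite opprD addrA subrr add0r -level_exponent; apply/(fil_opp n_gt0)/fil_gen.
Qed.

(** The digit b is that of the child chosen at i.  At j there is no choice, so that
the product represents y. *)
Lemma dl_step_affgen x y A i j : i != j -> represents x A -> dl_step x y i j ->
  exists b, represents y (A * affgen l (place_of i) (place_of j) b).
Proof.
move=> ij [P [-> PE]] [yi xj E]; have pij := place_of_neq ij.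
pose c := fun a => exponent x a + transfer (place_of i) (place_of j) a.
have hE k : h (val y k) = level c (place_of k).
  have [->|ki] := eqVneq k i.
    by rewrite level_transfer_up // level_exponent -yi (horo_par horoV) subrK.
  have [->|kj] := eqVneq k j.
    by rewrite level_transfer_down // level_exponent -xj (horo_par horoV).
  by rewrite level_transfer_other ?place_of_neq // level_exponent E.
have [Q QE] := BallP (phi (place_of i) (val y i)).
rewrite -/(ball_height _) phi_height hE level_transfer_up // in QE.
have := PE i; rewrite -yi phi_par QE ball_par_Ball // => /(BallE n_gt0)[_].
rewrite addrK => /(fil_digit l_unit pij)[b Mb]; exists b.
rewrite Gamma_mul_affgen; eexists; split.
  congr aff; apply: eq_monom => a; rewrite -/(c a).
  by have := hE (lift ord0 a); rewrite /place_of liftK /= => <-.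
move=> k; have [->|ki] := eqVneq k i.
  rewrite QE hE level_transfer_up //; apply/(BallE n_gt0); split=> //.
  by rewrite opprD addrA.
have [->|kj] := eqVneq k j.
  rewrite -xj phi_par PE ball_par_Ball // (horo_par horoV); apply/(BallE n_gt0); split=> //.
  by rewrite opprD addrA subrr add0r -level_exponent; apply/(fil_opp n_gt0)/fil_gen1.
rewrite -E // PE; apply/(BallE n_gt0); split=> //.
by rewrite opprD addrA subrr add0r -level_exponent; apply/(fil_opp n_gt0)/fil_gen/place_of_neq.
Qed.

Lemma represents_adj x y A B : represents x A -> represents y B ->
  DL_adj e omega o n.+1 x y <-> Gamma_gens l (A^-1 * B).
Proof.
move=> xA yB; have uA : A \is a GRing.unit.
  by case: (Gamma_subgroup l) => + _ _ _; apply; apply: represents_Gamma xA.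
split=> [/DL_adjE[i [j [ij xy]]]|/Gamma_gensE[p [p' [b [pp' E]]]]].
  have [b yb] := dl_step_affgen ij xA xy; apply/Gamma_gensE.
  exists (place_of i), (place_of j), b; split; first exact: place_of_neq.
  by rewrite (represents_functional yB yb) mulKr.
apply/DL_adjE; rewrite -(place_ofK p) -(place_ofK p') in pp' E.
set i := oapp _ _ p in pp' E; set j := oapp _ _ p' in pp' E.
exists i, j; split; first by apply: contra_neq pp' => ->.
apply: (affgen_dl_step _ xA (b := b)); first by apply: contra_neq pp' => ->.
by rewrite -E mulVKr.
Qed.

Lemma DL_iso_Gamma : graph_iso (DL_adj e omega o n.+1) (@cayley_adj _ (Gamma l) (Gamma_gens l)).
Proof.
have /choice[f fP] x : exists A : Gamma l, represents x (val A).
  have [A xA] := represents_total x.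
  by exists (SigSub (mem_set (represents_Gamma xA))).
have /choice[g gP] (A : Gamma l) : exists x, represents x (val A).
  exact/represents_surj/set_valP.
exists f; split=> [|x y]; last exact: represents_adj (fP x) (fP y).
exists g => [x|A]; first exact: represents_inj (gP _) (fP x).
exact/val_inj/(represents_functional (fP _) (gP A)).
Qed.

End DiestelLeader.

Theorem mainTheorem4 (q d : nat) (hq : (2 <= q)%N) (hd : (2 <= d)%N)
  (L : finComUnitRingType) (hL : #|L| = q)
  (l : 'I_d.-1 -> L) (hl : injective l)
  (hlu : forall i j, i != j -> (l i - l j)%R \is a GRing.unit)
  (* the homogeneous tree T_q with origin o and end omega *)
  (V : choiceType) (e : rel V) (hT : is_homogeneous_tree e q)
  (o : V) (omega : set (nat -> V)) (homega : is_end e omega) :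
  is_cayley_graph (DL_adj e omega o d) (Gamma l) (Gamma_gens l).
Proof.
case: d hd l hl hlu => [//|n] /= n_gt0 l _ hlu.
split; [exact: Gamma_subgroup | exact: Gamma_generating |].
rewrite -hL in hT; have [par [parE horoV]] := homogeneous_horotree o hT homega.
have iso p := cid (horotree_iso (0 : L) horoV (ball_horotree hlu n_gt0 p)).
apply: (DL_iso_Gamma hlu n_gt0 parE horoV (phi := fun p => sval (iso p))).
- by move=> p; case: (svalP (iso p)).
- by move=> p; case: (svalP (iso p)).
- by move=> p; case: (svalP (iso p)).
Qed.
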